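(* Let $R=\bigoplus_{n\in\mathbb{N}_0}R_n$ be a standard graded Noetherian ring whose base ring $(R_0,\mathfrak{m}_0)$ is local with infinite residue field, let $J_0\subseteq\mathfrak{m}_0$ be an ideal of $R_0$ and put $J:=J_0R$. Let $M$ be a finitely generated graded $R$-module and let $i\in\mathbb{N}_0$ be such that the $R$-module $H^{j}_{R_+,J}(M)$ is finitely generated for all $j<i$. Assume that one of the following (equivalent) conditions holds: (a) for every finitely generated graded $R$-module $N$ and every $k\in\mathbb{N}_0$, $H^{k}_{R_+,J}(N)_n=0$ for all $n\gg0$; (b) for every finitely generated graded $R$-module $N$, every $k\in\mathbb{N}_0$ and every $n\in\mathbb{Z}$, $H^{k}_{R_+,J}(N)_n$ is a finitely generated $R_0$-module. Then the sequence $\{\mathrm{Ass}_{R_0}(H^{i}_{R_+,J}(M)_n)\}_{n\in\mathbb{Z}}$ is asymptotically stable for $n\to-\infty$, i.e. there is $n_0\in\mathbb{Z}$ such that $\mathrm{Ass}_{R_0}(H^{i}_{R_+,J}(M)_n)=\mathrm{Ass}_{R_0}(H^{i}_{R_+,J}(M)_{n_0})$ for all $n\leq n_0$.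
   Context: All rings are commutative Noetherian with identity. ''Standard graded'' means that $R=\bigoplus_{n\in\mathbb{N}_0}R_n$ is generated as an $R_0$-algebra by finitely many elements of $R_1$; $R_+:=\bigoplus_{n\geq 1}R_n$. For ideals $I,J$ of $R$ and an $R$-module $M$, the $(I,J)$-torsion submodule is $\Gamma_{I,J}(M):=\{x\in M: I^nx\subseteq Jx \text{ for } n\gg 1\}$ (equivalently, $I^n\subseteq \mathrm{Ann}(x)+J$ for some $n$), and $H^i_{I,J}(-)$ is the $i$-th right derived functor of $\Gamma_{I,J}(-)$. If $I,J$ are homogeneous and $M$ is graded, then $H^i_{I,J}(M)$ is a graded $R$-module: take a resolution of $M$ by injective objects in the category of graded $R$-modules and homogeneous (degree $0$) homomorphisms, apply $\Gamma_{I,J}$ and take cohomology. $H^i_{I,J}(M)_n$ denotes the component of degree $n$, an $R_0$-module. ''For all $n\gg0$'' means for all sufficiently large integers $n$ (the bound may depend on the module and the index). *)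

(* Defs.v *)
From HB Require Import structures.
From mathcomp Require Import all_boot all_order all_algebra.
From mathcomp Require Import boolp classical_sets functions cardinality.

Set Implicit Arguments.
Unset Strict Implicit.
Unset Printing Implicit Defensive.

Import Order.TTheory GRing.Theory Num.Theory.

Local Open Scope ring_scope.
Local Open Scope quotient_scope.

(* Meant for a submodule [A] of [V]; ideals of [R], possibly improper, are
   submodules of the regular module [R^o]. *)
Definition fin_gen (R : pzRingType) (V : lmodType R) (A : {pred V}) : Prop :=
  exists s : seq V, {subset s <= A} /\
    forall x, x \in A ->
      exists c : nat -> R, x = \sum_(i < size s) c i *: s`_i.

Definition noetherian (R : comNzRingType) : Prop :=
  forall I : {pred R^o}, submod_closed I -> fin_gen I.

(* [idealr_closed] is the library's notion of a proper ideal. *)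
Definition maximal_ideal (R : comNzRingType) (m : {pred R}) : Prop :=
  idealr_closed m /\
  forall I : {pred R}, idealr_closed I -> {subset m <= I} -> I =i m.

Definition local_ring (R : comNzRingType) (m : {pred R}) : Prop :=
  maximal_ideal m /\ forall m' : {pred R}, maximal_ideal m' -> m' =i m.

Definition ideal_gen (R : comNzRingType) (A : {pred R}) : {pred R^o} :=
  [pred x : R^o | `[< exists s : seq (R * R),
     (forall p, p \in s -> p.2 \in A) /\ x = \sum_(p <- s) p.1 * p.2 >]].

Definition ideal_pow (R : comNzRingType) (I : {pred R}) (n : nat)
    : {pred R^o} :=
  ideal_gen [pred x : R | `[< exists s : seq R,
     [/\ size s = n, {subset s <= I} & x = \prod_(y <- s) y] >]].

Definition Ass (R : comNzRingType) (V : lmodType R) (A : {pred V})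
    : set {pred R} :=
  [set p | [/\ idealr_closed p, prime_idealr_closed p &
     exists2 x, x \in A & p =i [pred a | a *: x == 0]]]%classic.

Lemma ideal_gen_submod (R : comNzRingType) (A : {pred R}) :
  submod_closed (ideal_gen A).
Proof.
split=> [|a x y /asboolP[s [sA ->]] /asboolP[t [tA ->]]]; apply/asboolP.
  by exists [::]; split=> //; rewrite big_nil.
exists ([seq (a * p.1, p.2) | p <- s] ++ t); split.
  move=> p; rewrite mem_cat => /orP[/mapP[q qs ->]|/tA//]; exact: (sA q).
rewrite big_cat big_map /= /GRing.scale /= mulr_sumr; congr (_ + _).
by apply: eq_bigr => p _; rewrite mulrA.
Qed.

HB.instance Definition _ (R : comNzRingType) (A : {pred R}) :=
  GRing.isSubmodClosed.Build R R^o (ideal_gen A) (ideal_gen_submod A).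

Lemma ideal_gen_sub (R : comNzRingType) (A : {pred R}) (P : {pred R^o}) :
  submod_closed P -> {subset A <= P} -> {subset ideal_gen A <= P}.
Proof.
move=> [P0 PD] AP x /asboolP[s [sA ->]].
elim: s sA => [|p s IHs] sA; first by rewrite big_nil.
rewrite big_cons; apply: PD; first by apply/AP/sA; rewrite mem_head.
by apply: IHs => q qs; apply: sA; rewrite inE qs orbT.
Qed.

Definition torsion (R : comNzRingType) (I : {pred R}) (J : submodClosed R^o)
    (V : lmodType R) : {pred V} :=
  [pred x | `[< exists n0 : nat, forall n, (n0 <= n)%N ->
     forall a, a \in ideal_pow I n -> exists2 b, b \in J & a *: x = b *: x >]].

Arguments torsion {R} I J V.

Lemma torsion_submod (R : comNzRingType) (I : {pred R})
    (J : submodClosed R^o) (V : lmodType R) :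
  submod_closed (torsion I J V).
Proof.
have JM (c b : R) : b \in J -> c * b \in J by move=> ?; exact: rpredZ.
split=> [|c x y /asboolP[n0 hx] /asboolP[m0 hy]]; apply/asboolP.
  by exists 0%N => n _ a _; exists 0; rewrite ?rpred0 // !scaler0.
exists (n0 + m0)%N => n le_n a aI.
pose P : {pred R^o} := [pred r : R^o |
  `[< exists2 b, b \in J & (r : R) *: (c *: x + y) = b *: (c *: x + y) >]].
suff /asboolP : a \in P by [].
apply: ideal_gen_sub aI.
  split=> [|r u v /asboolP[b bJ ub] /asboolP[b' bJ' vb]]; apply/asboolP.
    by exists 0; rewrite ?rpred0.
  exists (r * b + b'); first by rewrite rpredD ?JM.
  by rewrite !scalerDl -scalerA ub vb scalerA.
move=> _ /asboolP[s [sz sI ->]].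
have ltake : size (take n0 s) = n0.
  by rewrite size_takel // sz; apply: leq_trans le_n; rewrite leq_addr.
have powP (t : seq R) : {subset t <= s} ->
    \prod_(z <- t) z \in ideal_pow I (size t).
  move=> ts; apply/asboolP; exists [:: (1, \prod_(z <- t) z)].
  rewrite big_seq1 mul1r; split=> // p; rewrite inE => /eqP -> /=.
  by apply/asboolP; exists t; split=> // z /ts/sI.
rewrite -(cat_take_drop n0 s) big_cat /=.
have /(hx _ (leqnn _))[b bJ eb] : \prod_(z <- take n0 s) z \in ideal_pow I n0.
  by rewrite -[X in ideal_pow I X]ltake; apply/powP => z /mem_take.
have [|b' bJ' eb'] := hy _ _ _ (powP (drop n0 s) (fun z => @mem_drop n0 _ s z)).
  by rewrite size_drop sz leq_subRL // (leq_trans _ le_n) ?leq_addr.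
move: (\prod_(z <- take n0 s) z) (\prod_(z <- drop n0 s) z) eb eb'.
move=> u v eb eb'; apply/asboolP; exists (u * b' + (v - b') * b).
  by rewrite rpredD ?JM.
have ex : ((v - b') * (u - b)) *: x = 0.
  by rewrite -scalerA [(u - b) *: x]scalerBl eb subrr scaler0.
have ey : ((u - b) * (v - b')) *: y = 0.
  by rewrite -scalerA [(v - b') *: y]scalerBl eb' subrr scaler0.
apply/eqP; rewrite -subr_eq0 -scalerBl.
have -> : u * v - (u * b' + (v - b') * b) = (u - b) * (v - b').
  by rewrite [RHS]mulrBl [X in _ = X - _]mulrBr [b * _]mulrC opprD addrA.
rewrite scalerDr ey addr0 scalerA [_ * c]mulrC -scalerA.
by rewrite [(u - b) * _]mulrC ex scaler0.
Qed.

HB.instance Definition _ (R : comNzRingType) (I : {pred R})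
    (J : submodClosed R^o) (V : lmodType R) :=
  GRing.isSubmodClosed.Build R V (torsion I J V) (torsion_submod I J V).

(* The library only forms the quotient of a [zmodType] by a [zmodClosed]
   predicate, and [submodClosed] does not coerce to [zmodClosed]. *)
Definition submod_pred (R : comNzRingType) (V : lmodType R)
  (B : submodClosed V) : {pred V} := [pred x | x \in B].

Lemma submod_pred_zmod (R : comNzRingType) (V : lmodType R)
  (B : submodClosed V) : zmod_closed (submod_pred B).
Proof.
split=> [|x y xB yB]; first exact: rpred0.
by rewrite inE -scaleN1r rpredD // rpredZ.
Qed.

HB.instance Definition _ (R : comNzRingType) (V : lmodType R)
    (B : submodClosed V) :=
  GRing.isZmodClosed.Build V (submod_pred B) (submod_pred_zmod B).

Definition quot_mod (R : comNzRingType) (V : lmodType R)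
  (B : submodClosed V) : Type := Quotient.quot (submod_pred B).

HB.instance Definition _ (R : comNzRingType) (V : lmodType R)
    (B : submodClosed V) := GRing.Zmodule.on (quot_mod B).

Definition quot_proj (R : comNzRingType) (V : lmodType R)
  (B : submodClosed V) (x : V) : quot_mod B := \pi_(Quotient.quot (submod_pred B)) x.

Definition quot_scale (R : comNzRingType) (V : lmodType R)
    (B : submodClosed V) (a : R) (u : quot_mod B) : quot_mod B :=
  quot_proj B (a *: repr (u : Quotient.quot (submod_pred B))).

Lemma quot_projP (R : comNzRingType) (V : lmodType R) (B : submodClosed V)
    (x y : V) : quot_proj B x = quot_proj B y <-> x - y \in B.
Proof.
have -> : (x - y \in B) = (x - y \in submod_pred B) by [].
by rewrite Quotient.idealrBE; split=> /eqP.
Qed.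

Lemma quot_projD (R : comNzRingType) (V : lmodType R) (B : submodClosed V)
    (x y : V) : quot_proj B (x + y) = quot_proj B x + quot_proj B y.
Proof. exact: (raddfD \pi_(Quotient.quot (submod_pred B))). Qed.

Lemma quot_projK (R : comNzRingType) (V : lmodType R) (B : submodClosed V)
    (u : quot_mod B) : quot_proj B (repr (u : Quotient.quot (submod_pred B))) = u.
Proof. exact: reprK. Qed.

Lemma quot_scaleE (R : comNzRingType) (V : lmodType R) (B : submodClosed V)
    (a : R) (x : V) : quot_scale a (quot_proj B x) = quot_proj B (a *: x).
Proof.
apply/quot_projP; rewrite -scalerBr rpredZ //.
by apply/quot_projP; rewrite quot_projK.
Qed.

Lemma quot_scaleA (R : comNzRingType) (V : lmodType R) (B : submodClosed V)
    (a b : R) (u : quot_mod B) :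
  quot_scale a (quot_scale b u) = quot_scale (a * b) u.
Proof. by rewrite -(quot_projK u) !quot_scaleE scalerA. Qed.

Lemma quot_scale1 (R : comNzRingType) (V : lmodType R) (B : submodClosed V) :
  left_id 1 (@quot_scale R V B).
Proof. by move=> u; rewrite -(quot_projK u) quot_scaleE scale1r. Qed.

Lemma quot_scaleDr (R : comNzRingType) (V : lmodType R) (B : submodClosed V) :
  right_distributive (@quot_scale R V B) +%R.
Proof.
move=> a u v; rewrite -(quot_projK u) -(quot_projK v).
by rewrite -quot_projD !quot_scaleE scalerDr quot_projD.
Qed.

Lemma quot_scaleDl (R : comNzRingType) (V : lmodType R) (B : submodClosed V)
    (u : quot_mod B) : {morph (@quot_scale R V B)^~ u : a b / a + b}.
Proof.
by move=> a b; rewrite -(quot_projK u) !quot_scaleE scalerDl quot_projD.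
Qed.

HB.instance Definition _ (R : comNzRingType) (V : lmodType R)
    (B : submodClosed V) :=
  GRing.Zmodule_isLmodule.Build R (quot_mod B)
    (@quot_scaleA R V B) (@quot_scale1 R V B)
    (@quot_scaleDr R V B) (@quot_scaleDl R V B).

Definition restr_scalars (R0 : comNzRingType) (R : comAlgType R0)
  (V : lmodType R) : Type := V.

HB.instance Definition _ (R0 : comNzRingType) (R : comAlgType R0)
    (V : lmodType R) := GRing.Zmodule.on (restr_scalars V).

Definition restr_scale (R0 : comNzRingType) (R : comAlgType R0)
    (V : lmodType R) (a : R0) (x : restr_scalars V) : restr_scalars V :=
  a%:A *: (x : V).

Lemma restr_scaleA (R0 : comNzRingType) (R : comAlgType R0) (V : lmodType R)
    (a b : R0) (x : restr_scalars V) :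
  restr_scale a (restr_scale b x) = restr_scale (a * b) x.
Proof. by rewrite /restr_scale !scalerA -scalerAl mul1r scalerA. Qed.

Lemma restr_scale1 (R0 : comNzRingType) (R : comAlgType R0) (V : lmodType R) :
  left_id 1 (@restr_scale R0 R V).
Proof. by move=> x; rewrite /restr_scale !scale1r. Qed.

Lemma restr_scaleDr (R0 : comNzRingType) (R : comAlgType R0) (V : lmodType R) :
  right_distributive (@restr_scale R0 R V) +%R.
Proof. by move=> a x y; rewrite /restr_scale scalerDr. Qed.

Lemma restr_scaleDl (R0 : comNzRingType) (R : comAlgType R0) (V : lmodType R)
    (x : restr_scalars V) : {morph (@restr_scale R0 R V)^~ x : a b / a + b}.
Proof. by move=> a b; rewrite /restr_scale !scalerDl. Qed.

HB.instance Definition _ (R0 : comNzRingType) (R : comAlgType R0)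
    (V : lmodType R) :=
  GRing.Zmodule_isLmodule.Build R0 (restr_scalars V)
    (@restr_scaleA R0 R V) (@restr_scale1 R0 R V)
    (@restr_scaleDr R0 R V) (@restr_scaleDl R0 R V).

(* [V] is the internal direct sum of the subgroups [D n]. *)
Definition grading (K : eqType) (V : zmodType) (D : K -> {pred V}) : Prop :=
  [/\ forall n, zmod_closed (D n),
      forall x, exists s : seq K, exists f : K -> V,
        (forall n, f n \in D n) /\ x = \sum_(n <- s) f n &
      forall (s : seq K) (f : K -> V), uniq s -> (forall n, f n \in D n) ->
        \sum_(n <- s) f n = 0 -> forall n, n \in s -> f n = 0].

(* The base ring [R0] is identified with the component of degree 0 through
   the structure map [a |-> a%:A] of the [R0]-algebra [R]. *)
Record standard_graded (R0 : comNzRingType) (R : comAlgType R0)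
    (Rn : nat -> {pred R}) : Prop := StandardGraded {
  sg_grading : grading Rn;
  sg_mul : forall m n r s, r \in Rn m -> s \in Rn n -> r * s \in Rn (m + n)%N;
  sg_base : forall r, r \in Rn 0%N <-> exists a : R0, r = a%:A;
  sg_base_inj : injective (fun a : R0 => a%:A : R);
  sg_gen : exists s : seq R, {subset s <= Rn 1%N} /\
    forall S : {pred R}, subalg_closed S -> {subset s <= S} -> S =i predT
}.

Definition irrelevant (R0 : comNzRingType) (R : comAlgType R0)
    (Rn : nat -> {pred R}) : {pred R} :=
  [pred r | `[< exists N : nat, exists f : nat -> R,
     (forall n, f n \in Rn n) /\ r = \sum_(1 <= n < N) f n >]].

Definition extend_ideal (R0 : comNzRingType) (R : comAlgType R0)
    (J0 : {pred R0}) : {pred R^o} :=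
  ideal_gen [pred r : R | `[< exists2 a, a \in J0 & r = a%:A >]].

Arguments extend_ideal {R0} R J0.

HB.instance Definition _ (R0 : comNzRingType) (R : comAlgType R0)
    (J0 : {pred R0}) :=
  GRing.SubmodClosed.on (extend_ideal R J0).

Record grmod (R0 : comNzRingType) (R : comAlgType R0) (Rn : nat -> {pred R})
    := GrMod {
  gm_sort :> lmodType R;
  gm_deg : int -> {pred gm_sort};
  gm_grading : grading gm_deg;
  gm_scale : forall (m : nat) (n : int) (r : R) (x : gm_sort),
    r \in Rn m -> x \in gm_deg n -> r *: x \in gm_deg (m%:Z + n)
}.

Arguments gm_deg {R0 R Rn} M n : rename.

Definition homogeneous (R0 : comNzRingType) (R : comAlgType R0)
    (Rn : nat -> {pred R}) (M N : grmod Rn) (f : M -> N) : Prop :=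
  forall n x, x \in gm_deg M n -> f x \in gm_deg N n.

Definition gr_injective (R0 : comNzRingType) (R : comAlgType R0)
    (Rn : nat -> {pred R}) (E : grmod Rn) : Prop :=
  forall (A B : grmod Rn) (f : {linear A -> B}) (g : {linear A -> E}),
    homogeneous f -> homogeneous g -> injective f ->
    exists2 h : {linear B -> E}, homogeneous h & forall x, h (f x) = g x.

Record gr_inj_resolution (R0 : comNzRingType) (R : comAlgType R0)
    (Rn : nat -> {pred R}) (M : grmod Rn) := GrInjResolution {
  res_obj :> nat -> grmod Rn;
  res_aug : {linear M -> res_obj 0%N};
  res_d : forall k, {linear res_obj k -> res_obj k.+1};
  res_inj : forall k, gr_injective (res_obj k);
  res_aug_homog : homogeneous res_aug;
  res_d_homog : forall k, homogeneous (res_d k);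
  res_aug_inj : injective res_aug;
  res_exact0 : forall x, res_d 0%N x = 0 <-> exists y, x = res_aug y;
  res_exactS : forall k x,
    res_d k.+1 x = 0 <-> exists y, x = res_d k y
}.

Arguments res_d {R0 R Rn M} E k : rename.

Definition cocycle (R0 : comNzRingType) (R : comAlgType R0)
    (Rn : nat -> {pred R}) (I : {pred R}) (J : submodClosed R^o)
    (M : grmod Rn) (E : gr_inj_resolution M) (k : nat) : {pred E k} :=
  [pred x | (x \in torsion I J (E k)) && (res_d E k x == 0)].

Definition coboundary (R0 : comNzRingType) (R : comAlgType R0)
    (Rn : nat -> {pred R}) (I : {pred R}) (J : submodClosed R^o)
    (M : grmod Rn) (E : gr_inj_resolution M) (k : nat) : {pred E k} :=
  match k with
  | 0%N => pred1 0
  | j.+1 => [pred y | `[< exists2 x, x \in torsion I J (E j) &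
                           y = res_d E j x >]]
  end.

Arguments cocycle {R0 R Rn} I J {M} E k.
Arguments coboundary {R0 R Rn} I J {M} E k.

Lemma coboundary_submod (R0 : comNzRingType) (R : comAlgType R0)
    (Rn : nat -> {pred R}) (I : {pred R}) (J : submodClosed R^o)
    (M : grmod Rn) (E : gr_inj_resolution M) (k : nat) :
  submod_closed (coboundary I J E k).
Proof.
case: k => [|k] /=; split.
- exact: eqxx.
- by move=> a x y /eqP -> /eqP ->; rewrite scaler0 addr0 inE.
- by apply/asboolP; exists 0; rewrite ?rpred0 ?linear0.
- move=> a x y /asboolP[u ut ->] /asboolP[v vt ->]; apply/asboolP.
  by exists (a *: u + v); rewrite ?linearP // rpredD // rpredZ.
Qed.

HB.instance Definition _ (R0 : comNzRingType) (R : comAlgType R0)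
    (Rn : nat -> {pred R}) (I : {pred R}) (J : submodClosed R^o)
    (M : grmod Rn) (E : gr_inj_resolution M) (k : nat) :=
  GRing.isSubmodClosed.Build R (E k) (coboundary I J E k)
    (coboundary_submod I J E k).

(* The k-th cohomology module of the complex of torsion submodules of [E] is
   realized as the submodule Z / B of E^k / B, with Z the cocycles and B the
   coboundaries of that complex.  It is computed from a given resolution;
   statements about it quantify over all graded injective resolutions. *)
Definition loc_coh (R0 : comNzRingType) (R : comAlgType R0)
    (Rn : nat -> {pred R}) (I : {pred R}) (J : submodClosed R^o)
    (M : grmod Rn) (E : gr_inj_resolution M) (k : nat) :
    {pred quot_mod (coboundary I J E k)} :=
  [pred u | `[< exists2 x, x \in cocycle I J E k & u = quot_proj _ x >]].

(* The component of degree n of [loc_coh]: the classes of the homogeneous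
   cocycles of degree n, as a subset of an [R0]-module. *)
Definition loc_coh_deg (R0 : comNzRingType) (R : comAlgType R0)
    (Rn : nat -> {pred R}) (I : {pred R}) (J : submodClosed R^o)
    (M : grmod Rn) (E : gr_inj_resolution M) (k : nat) (n : int) :
    {pred restr_scalars (quot_mod (coboundary I J E k))} :=
  [pred u : quot_mod (coboundary I J E k) |
    `[< exists x, [/\ x \in cocycle I J E k, x \in gm_deg (E k) n &
                      u = quot_proj _ x] >]].

Arguments loc_coh {R0 R Rn} I J {M} E k.
Arguments loc_coh_deg {R0 R Rn} I J {M} E k n.

(* Main.v *)
From HB Require Import structures.
Require Import Defs.
From mathcomp Require Import all_boot all_order all_algebra.
From mathcomp Require Import boolp classical_sets functions cardinality.
From mathcomp Require Import zify.

(* Because J0 is contained in m0, Nakayama's lemma shows that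
   (R_+, J)-torsion is componentwise torsion with respect to powers of
   generators s = (x_1, ..., x_r) of R_1, so the pair plays no role beyond R_+.
   Let X be the complex of torsion submodules of the resolution E, and let
   K_l be its iterated mapping cone along x_1, ..., x_l.  The long exact
   sequence of K_(l+1) = cone (x_(l+1) on K_l) shows, when H^j(K_l) vanishes in
   very negative degrees for j < i, that
     0 -> H^i(K_(l+1))_n -> H^i(K_l)_n -> H^i(K_l)_(n+1)
   is exact for n << 0.  So if Ass H^i(K_(l+1))_n is eventually a constant set,
   it is contained in every Ass H^i(K_l)_n, and these sets decrease as
   n -> -oo; they are finite, hence eventually constant.  By descending
   induction on l it remains to see that H^i(K_r)_n = 0 for n << 0.  On an
   injective module, x acts bijectively modulo x-torsion, so K_r has the
   cohomology of the Koszul complex of E on s, which is that of M on s. *)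

Set Implicit Arguments.
Unset Strict Implicit.
Unset Printing Implicit Defensive.

Import Order.TTheory GRing.Theory Num.Theory.
Local Open Scope ring_scope.

(** * Noetherian subquotients *)

(** Conditions (a) and (b) enter through one consequence: each H^k(X)_n is finitely generated over
    R_0. Under (b) this is assumed. Under (a) it is carried from K_r back to X: the Koszul
    cohomology of M has finitely generated components, and the exact sequence H^k(K_(l+1))_n ->
    H^k(K_l)_n -> H^k(K_l)_(n+1) transfers finiteness from K_(l+1) to K_l, by induction downwards
    from a degree above which H^k(K_l) vanishes. X is compared with E by adding the elements of s to
    the torsion condition one at a time. Adding x changes the complex by a quotient on which x is
    bijective, and a Koszul complex on a sequence containing x does not see such a quotient. The
    delicate point in identifying the torsion is that its elements, and hence their annihilators,
    need not be homogeneous. Cohomology is handled without quotients: two predicates Z and B on one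
    module stand for it, so that a cone is just a product V x V with new predicates. *)

Section Submodules.
Variables (A : comNzRingType) (V : lmodType A).

Definition is_submod (S : V -> Prop) : Prop :=
  S 0 /\ forall a u v, S u -> S v -> S (a *: u + v).

(** The span as an intersection of submodules, so that induction over a span is plain application;
    [lspan_sum] recovers coefficients. *)
Definition lspan (s : seq V) (v : V) : Prop :=
  forall S, is_submod S -> (forall x, x \in s -> S x) -> S v.

Section Closure.
Variables (S : V -> Prop) (hS : is_submod S).

Lemma submod0 : S 0. Proof. by case: hS. Qed.
Lemma submodD u v : S u -> S v -> S (u + v).
Proof. by move=> Su Sv; rewrite -[u]scale1r; apply: (proj2 hS). Qed.
Lemma submodZ a u : S u -> S (a *: u).
Proof. by move=> Su; rewrite -[_ *: _]addr0; apply: (proj2 hS) => //; apply: submod0. Qed.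
Lemma submodN u : S u -> S (- u).
Proof. by move=> Su; rewrite -scaleN1r; apply: submodZ. Qed.
Lemma submodB u v : S u -> S v -> S (u - v).
Proof. by move=> Su Sv; apply: submodD => //; apply: submodN. Qed.
Lemma submod_subr u v : S (u - v) -> S v -> S u.
Proof. by move=> Suv Sv; rewrite -(subrK v u); apply: submodD. Qed.
Lemma submod_subl u v : S (u - v) -> S u -> S v.
Proof. by move=> Suv Su; rewrite -(subKr u v); apply: submodB. Qed.
End Closure.

Lemma lspan_submod s : is_submod (lspan s).
Proof.
split=> [S hS _|a u v hu hv S hS sS]; first exact: submod0.
by apply: (proj2 hS); [apply: hu | apply: hv].
Qed.

Lemma lspan_mem s x : x \in s -> lspan s x.
Proof. by move=> xs S _; apply. Qed.

Lemma lspan_min s (S : V -> Prop) v :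
  is_submod S -> (forall x, x \in s -> S x) -> lspan s v -> S v.
Proof. by move=> hS sS; apply. Qed.

Lemma lspan_cons x s v :
  lspan (x :: s) v -> exists a w, lspan s w /\ v = a *: x + w.
Proof.
move=> hv; pattern v; apply: lspan_min hv => [|y]; first split.
- by exists 0, 0; rewrite scale0r addr0; split=> //; exact: (submod0 (lspan_submod s)).
- move=> a u v' [b [w [hw ->]]] [c [w' [hw' ->]]]; exists (a * b + c), (a *: w + w').
  by split; [apply: (proj2 (lspan_submod s)) | rewrite scalerDr scalerDl scalerA addrACA].
rewrite inE => /orP[/eqP ->|ys].
  by exists 1, 0; rewrite scale1r addr0; split=> //; exact: (submod0 (lspan_submod s)).
by exists 0, y; rewrite scale0r add0r; split=> //; apply: lspan_mem.
Qed.

Lemma lspan_nil v : lspan [::] v -> v = 0.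
Proof.
move=> hv; pattern v; apply: lspan_min hv => //; split=> // a u w -> ->; by rewrite scaler0 addr0.
Qed.

Lemma lspan_sum (s : seq V) v :
  lspan s v <-> exists c : nat -> A, v = \sum_(i < size s) c i *: s`_i.
Proof.
split=> [hv|[c ->]].
  pattern v; apply: lspan_min hv => [|x xs]; first split.
  - by exists (fun=> 0); rewrite big1 // => i _; rewrite scale0r.
  - move=> a u w [c ->] [c' ->]; exists (fun i => a * c i + c' i).
    rewrite scaler_sumr -big_split; apply: eq_bigr => i _.
    by rewrite scalerDl scalerA.
  have ix : (index x s < size s)%N by rewrite index_mem.
  exists (fun i => (i == index x s)%:R); rewrite (bigD1 (Ordinal ix)) //= eqxx.
  rewrite scale1r nth_index // big1 ?addr0 // => i ni.
  by rewrite (negPf (ni : (i : nat) != _)) scale0r.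
have hs := lspan_submod s.
apply: (big_ind (lspan s)); first exact: (submod0 hs).
  by move=> *; apply: (submodD hs).
by move=> i _; apply: (submodZ hs); apply: lspan_mem; apply: mem_nth.
Qed.

(* A pair [Z], [B] of submodules stands for the subquotient [Z / (Z :&: B)]. *)
Definition noeth (Z B : V -> Prop) : Prop :=
  forall S, is_submod S -> (forall v, S v -> Z v) ->
  exists s : seq V, (forall x, x \in s -> S x) /\
    forall v, S v -> exists w, lspan s w /\ B (v - w).

Lemma is_submod1 : is_submod (eq^~ 0).
Proof. by split=> // a u v -> ->; rewrite scaler0 addr0. Qed.

Lemma noeth_triv (Z B : V -> Prop) : (forall v, Z v -> B v) -> noeth Z B.
Proof.
move=> ZB S hS SZ; exists [::]; split=> // v Sv.
by exists 0; split; [exact: (submod0 (lspan_submod _)) | rewrite subr0; apply/ZB/SZ].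
Qed.

(** The union of the chain has finitely many generators modulo [B], and these already lie in one
    member. *)
Lemma acc (Z B : V -> Prop) (S : nat -> V -> Prop) :
  is_submod B -> noeth Z B -> (forall n, is_submod (S n)) ->
  (forall n v, S n v -> Z v) -> (forall n v, S n v -> S n.+1 v) ->
  exists N, forall n v, S n v -> exists w, S N w /\ B (v - w).
Proof.
move=> hB hN hS SZ Sinc.
have Smono m n v : (m <= n)%N -> S m v -> S n v.
  move=> /subnK <-; elim: (n - m)%N => // k IH /IH; rewrite addSn; exact: Sinc.
have hU : is_submod (fun v => exists n, S n v).
  split=> [|a u v [m Su] [n Sv]]; first by exists 0%N; exact: submod0.
  exists (maxn m n); apply: (proj2 (hS _)).
    by apply: Smono Su; apply: leq_maxl.
  by apply: Smono Sv; apply: leq_maxr.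
have [|s [sS sgen]] := hN _ hU; first by move=> v [n]; apply: SZ.
have [N hNs] : exists N, forall x, x \in s -> S N x.
  elim: s sS {sgen} => [|x s IH] sS; first by exists 0%N.
  have [N hNs] := IH (fun y ys => sS y (mem_behead (s := x :: s) ys)).
  have [m Sx] := sS x (mem_head _ _).
  exists (maxn m N) => y; rewrite inE => /orP[/eqP ->|/hNs].
    by apply: Smono Sx; apply: leq_maxl.
  by apply: Smono; apply: leq_maxr.
exists N => n v Sv; have [|w [hw Bw]] := sgen v; first by exists n.
by exists w; split=> //; apply: lspan_min hw.
Qed.

(** Without a maximal member, choice builds a strictly increasing chain. Members contain [B], so
    stabilisation modulo [B], given by [acc], is stabilisation. *)
Lemma noeth_max (Z B : V -> Prop) (P : (V -> Prop) -> Prop) (S0 : V -> Prop) :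
  is_submod B -> noeth Z B -> P S0 ->
  (forall S, P S -> [/\ is_submod S, forall v, S v -> Z v & forall v, B v -> S v]) ->
  exists S, P S /\
    forall S', P S' -> (forall v, S v -> S' v) -> forall v, S' v -> S v.
Proof.
move=> hB hN PS0 hP; apply: contrapT => nomax.
have step (T : {S | P S}) : exists T' : {S | P S},
    (forall v, sval T v -> sval T' v) /\ exists v, sval T' v /\ ~ sval T v.
  case: T => S PS /=; apply: contrapT => nostep; apply: nomax; exists S.
  split=> // S' PS' SS' v S'v; apply: contrapT => nSv; apply: nostep.
  by exists (exist _ S' PS'); split=> //; exists v.
have [next hnext] := choice step.
pose T n := sval (iter n next (exist _ S0 PS0)).
have PT n : P (T n) := svalP (iter n next (exist _ S0 PS0)).
have [|||N hNT] := @acc Z B T hB hN.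
- by move=> n; case: (hP _ (PT n)).
- by move=> n; case: (hP _ (PT n)).
- by move=> n; have [] := hnext (iter n next (exist _ S0 PS0)).
have [_ [v [Tv nTv]]] := hnext (iter N next (exist _ S0 PS0)).
have [w [Tw Bvw]] := hNT N.+1 v Tv.
have [hS _ BS] := hP _ (PT N).
by apply: nTv; apply: (submod_subr hS (BS _ Bvw)).
Qed.

End Submodules.

(** Exactness of Z'/B' -> Z/B -> Z''/B'' in the middle is enough: [S] is generated by lifts of
    generators of its image in Z'' together with generators of the part of [S] coming from Z'. *)
Lemma noeth_ext (A : comNzRingType) (V' V V'' : lmodType A)
    (Z' B' : V' -> Prop) (Z B : V -> Prop) (Z'' B'' : V'' -> Prop)
    (f : V' -> V) (g : V -> V'') :
  (forall a u v, f (a *: u + v) = a *: f u + f v) ->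
  (forall a u v, g (a *: u + v) = a *: g u + g v) ->
  is_submod Z' -> is_submod B ->
  (forall v, B' v -> B (f v)) -> (forall v, Z v -> Z'' (g v)) ->
  (forall v, Z v -> B'' (g v) -> exists z, Z' z /\ B (v - f z)) ->
  noeth Z' B' -> noeth Z'' B'' -> noeth Z B.
Proof.
move=> fL gL hZ' hB fB gZ ex hN' hN'' S hS SZ.
have f0 : f 0 = 0 by have := fL (-1) 0 0; rewrite scaler0 addr0 scaleN1r addNr.
have g0 : g 0 = 0 by have := gL (-1) 0 0; rewrite scaler0 addr0 scaleN1r addNr.
have fB' u v : f (u - v) = f u - f v.
  by rewrite addrC -scaleN1r fL scaleN1r addrC.
have gB' u v : g (u - v) = g u - g v.
  by rewrite addrC -scaleN1r gL scaleN1r addrC.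
pose S'' w := exists2 v, S v & w = g v.
have [||s'' [s''S s''gen]] := hN'' S''.
- split=> [|a u v [x Sx ->] [y Sy ->]]; first by exists 0; rewrite ?g0 //; apply: submod0.
  by exists (a *: x + y); rewrite ?gL //; apply: (proj2 hS).
- by move=> _ [v /SZ/gZ ? ->].
have [t [tS ts'']] : exists t : seq V, (forall x, x \in t -> S x) /\ s'' = map g t.
  elim: s'' s''S {s''gen} => [|x s IH] sS; first by exists [::].
  have [t [tS ->]] := IH (fun y ys => sS y (mem_behead (s := x :: s) ys)).
  have [v Sv ->] := sS x (mem_head _ _).
  by exists (v :: t); split=> // y; rewrite inE => /orP[/eqP ->|/tS].
(* The preimage of [S] modulo [B]. The representatives [u] in [S], not the values of [f], become the
   generators [t']. *)
pose S' z := Z' z /\ exists2 u, S u & B (f z - u).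
have [||s' [s'S s'gen]] := hN' S'.
- split.
    by split; [apply: submod0 | exists 0; rewrite ?f0 ?subr0; apply: submod0].
  move=> a u v [Zu [x Sx Bx]] [Zv [y Sy By]]; split; first exact: (proj2 hZ').
  exists (a *: x + y); first exact: (proj2 hS).
  by rewrite fL opprD addrACA -scalerBr; apply: (proj2 hB).
- by move=> z [].
have [t' [t'S t's']] : exists t' : seq V, (forall x, x \in t' -> S x) /\
    forall z, lspan s' z -> exists w, lspan t' w /\ B (f z - w).
  elim: s' s'S {s'gen} => [|x s IH] sS.
    exists [::]; split=> // z /lspan_nil ->; exists 0.
    by rewrite f0 subr0; split; [exact: (submod0 (lspan_submod _)) | apply: submod0].
  have [t' [t'S tgen]] := IH (fun y ys => sS y (mem_behead (s := x :: s) ys)).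
  have [_ [u Su Bu]] := sS x (mem_head _ _).
  exists (u :: t'); split=> [y|z]; first by rewrite inE => /orP[/eqP ->|/t'S].
  move=> /lspan_cons[a [w [/tgen[w' [hw' Bw']] ->]]]; exists (a *: u + w'); split.
    apply: (proj2 (lspan_submod _)); first by apply: lspan_mem; rewrite mem_head.
    apply: lspan_min hw'; first exact: lspan_submod.
    by move=> y yt; apply: lspan_mem; rewrite inE yt orbT.
  by rewrite fL opprD addrACA -scalerBr; apply: (proj2 hB).
exists (t ++ t'); split=> [x|v Sv]; first by rewrite mem_cat => /orP[/tS|/t'S].
have spl w : lspan t w -> lspan (t ++ t') w.
  apply: lspan_min; first exact: lspan_submod.
  by move=> y yt; apply: lspan_mem; rewrite mem_cat yt.
have spr w : lspan t' w -> lspan (t ++ t') w.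
  apply: lspan_min; first exact: lspan_submod.
  by move=> y yt; apply: lspan_mem; rewrite mem_cat yt orbT.
have [w'' [hw'' Bw'']] := s''gen (g v) (ex_intro2 _ _ v Sv erefl).
have [w [hw ew]] : exists w, lspan t w /\ w'' = g w.
  pattern w''; apply: lspan_min hw''; first split.
  - by exists 0; rewrite g0; split=> //; exact: (submod0 (lspan_submod _)).
  - move=> a _ _ [x [hx ->]] [y [hy ->]]; exists (a *: x + y).
    by rewrite gL; split=> //; apply: (proj2 (lspan_submod _)).
  by rewrite ts'' => _ /mapP[y yt ->]; exists y; split=> //; apply: lspan_mem.
have Sw : S w by apply: lspan_min hw.
have [||z [Zz Bz]] := ex (v - w).
- by apply: SZ; apply: submodB.
- by rewrite gB' -ew.
have [|z' [hz' Bz']] := s'gen z.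
  split=> //; exists (v - w); first exact: submodB.
  by rewrite -opprB; apply: submodN.
have [w' [hw' Bw']] := t's' _ hz'.
(* v - w - w' is the sum of v - w - f z, f (z - z') and f z' - w', all three in [B]. *)
exists (w + w'); split; first by apply: (submodD (lspan_submod _)); [apply: spl|apply: spr].
rewrite opprD addrA -(subrK (f z) (v - w)) -addrA; apply: submodD => //.
rewrite -(subrK (f z') (f z)) -addrA; apply: submodD => //.
by rewrite -fB'; apply: fB.
Qed.

Lemma noeth_inj (A : comNzRingType) (V W : lmodType A)
    (Z B : V -> Prop) (Z' B' : W -> Prop) (g : V -> W) :
  (forall a u v, g (a *: u + v) = a *: g u + g v) -> is_submod B ->
  (forall v, Z v -> Z' (g v)) -> (forall v, Z v -> B' (g v) -> B v) ->
  noeth Z' B' -> noeth Z B.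
Proof.
move=> gL hB gZ gB; apply: (@noeth_ext _ V V W (eq^~ 0) (eq^~ 0) _ _ _ _ id) => //.
- exact: is_submod1.
- by move=> _ ->; apply: submod0.
- by move=> v Zv /(gB _ Zv) Bv; exists 0; rewrite subr0.
- exact: noeth_triv.
Qed.

Lemma noeth_surj (A : comNzRingType) (V W : lmodType A)
    (Z B : V -> Prop) (Z' B' : W -> Prop) (f : W -> V) :
  (forall a u v, f (a *: u + v) = a *: f u + f v) ->
  is_submod Z' -> is_submod B ->
  (forall w, B' w -> B (f w)) -> (forall v, Z v -> exists w, Z' w /\ B (v - f w)) ->
  noeth Z' B' -> noeth Z B.
Proof.
move=> fL hZ' hB fB fZ hN.
apply: (@noeth_ext _ W V V Z' B' _ _ (fun=> True) (fun=> True) f id) => //.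
- by move=> v Zv _; apply: fZ.
- exact: noeth_triv.
Qed.

(** Induction on the generators: modulo the span of [s], the span of [x :: s] is cyclic, an image of
    [A]. *)
Lemma noeth_span (A : comNzRingType) (V : lmodType A) (s : seq V) :
  @noeth A A^o (fun=> True) (eq^~ 0) -> noeth (lspan s) (eq^~ 0).
Proof.
move=> hA; elim: s => [|x s IH]; first by apply: noeth_triv => v /lspan_nil.
have hs := lspan_submod s.
apply: (@noeth_ext _ V V V (lspan s) (eq^~ 0) _ _ (lspan (x :: s)) (lspan s) id id) => //.
- exact: is_submod1.
- by move=> v _ hv; exists v; rewrite subrr.
apply: (@noeth_surj _ V A^o _ _ (fun=> True) (eq^~ 0) (fun a => a *: x)) => //.
- by move=> a u v; rewrite scalerDl scalerA.
- by move=> _ ->; rewrite scale0r; apply: submod0.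
- by move=> v /lspan_cons[a [w [hw ->]]]; exists a; rewrite addrC addKr.
Qed.

(** * Associated primes of subquotients *)

Definition assq (A : comNzRingType) (V : lmodType A) (Z B : V -> Prop)
    (p : {pred A}) : Prop :=
  [/\ idealr_closed p, prime_idealr_closed p &
      exists2 z, Z z & forall a, a \in p <-> B (a *: z)].

Lemma assq_sub (A : comNzRingType) (V' V : lmodType A)
    (Z' B' : V' -> Prop) (Z B : V -> Prop) (f : V' -> V) p :
  (forall a u, f (a *: u) = a *: f u) ->
  (forall z, Z' z -> Z (f z)) -> is_submod Z' ->
  (forall z, Z' z -> B' z <-> B (f z)) ->
  assq Z' B' p -> assq Z B p.
Proof.
move=> fZ ZZ hZ' BB [ip pp [z Zz hz]]; split=> //; exists (f z); first exact: ZZ.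
by move=> a; rewrite hz -fZ; apply: BB; apply: submodZ.
Qed.

(** Let p be the annihilator of the class of z. If some a outside p sends z into the image of Z',
    then a z still has annihilator p, by primality, and comes from Z'. Otherwise the image of z in
    Z''/B'' has annihilator p. *)
Lemma assq_ext (A : comNzRingType) (V' V V'' : lmodType A)
    (Z' B' : V' -> Prop) (Z B : V -> Prop) (Z'' B'' : V'' -> Prop)
    (f : V' -> V) (g : V -> V'') p :
  (forall a u, f (a *: u) = a *: f u) -> (forall a u, g (a *: u) = a *: g u) ->
  is_submod Z -> is_submod B -> is_submod Z' ->
  (forall z, Z' z -> B' z <-> B (f z)) ->
  (forall z, Z z -> Z'' (g z)) -> (forall z, B z -> B'' (g z)) ->
  (forall z, Z z -> B'' (g z) -> exists z', Z' z' /\ B (z - f z')) ->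
  assq Z B p -> assq Z' B' p \/ assq Z'' B'' p.
Proof.
move=> fZ gZ hZ hB hZ' BB ZZ gB ex [ip pp [z Zz hz]].
have [[a [ap Ba]]|none] := pselect (exists a, a \notin p /\ B'' (g (a *: z))).
  have [|z' [Zz' Bz']] := ex (a *: z) _ Ba; first exact: submodZ.
  left; split=> //; exists z' => // b; rewrite BB; last exact: submodZ.
  have Bb : B (b *: (a *: z) - b *: f z') by rewrite -scalerBr; apply: submodZ.
  rewrite fZ; transitivity (B (b *: (a *: z))); last first.
    by split; [apply: submod_subl|apply: submod_subr].
  rewrite scalerA -hz; split=> [bp|/pp/orP[//|]]; last by rewrite (negPf ap).
  by case: ip => p0 _ pD; rewrite mulrC -[_ * _]addr0; apply: pD.
right; split=> //; exists (g z); first exact: ZZ.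
move=> a; rewrite -gZ; split=> [/hz/gB//|Ba].
by apply: contrapT => /negP ap; apply: none; exists a.
Qed.

(** A maximal annihilator of a nonzero class is prime. *)
Lemma exists_assq (A : comNzRingType) (V : lmodType A) (Z B : V -> Prop) :
  @noeth A A^o (fun=> True) (eq^~ 0) -> is_submod Z -> is_submod B ->
  (exists2 z, Z z & ~ B z) -> exists p, assq Z B p.
Proof.
move=> hA hZ hB [z0 Zz0 nBz0].
pose ann z : A^o -> Prop := fun a => B ((a : A) *: z).
have hann z : is_submod (ann z).
  split=> [|a u v Bu Bv]; first by rewrite /ann scale0r; apply: submod0.
  by rewrite /ann scalerDl -scalerA; apply: (proj2 hB).
pose P S := exists z, [/\ Z z, ~ B z & S = ann z].
have [|||_ [[z [Zz nBz ->]] zmax]] := noeth_max (P := P) (S0 := ann z0) _ hA.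
- exact: is_submod1.
- by exists z0.
- by move=> _ [z [_ _ ->]]; split=> // v ->; apply: submod0.
pose p : {pred A} := fun a => `[< ann z a >].
have pE a : a \in p <-> B (a *: z) by rewrite unfold_in /p; split=> /asboolP.
exists p; split; last by exists z.
  split; first by apply/pE; rewrite scale0r; apply: submod0.
    by apply/negP => /pE; rewrite scale1r.
  by move=> a u v /pE Bu /pE Bv; apply/pE; apply: (proj2 (hann z)).
move=> u v /pE Buv; have [Bv|nBv] := pselect (B (v *: z)).
  by apply/orP; right; apply/pE.
apply/orP; left; apply/pE; apply: (zmax (ann (v *: z))).
- by exists (v *: z); split=> //; apply: submodZ.
- move=> a Ba; rewrite /ann scalerA mulrC -scalerA; exact: submodZ.
- by rewrite /ann scalerA.
Qed.

(** Instead of a prime filtration, take a maximal S between B and Z for which S/B has finitely many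
    associated primes. If S were smaller than Z, a copy of A/p inside Z/S would enlarge it at the
    cost of one prime. *)
Lemma assq_finite (A : comNzRingType) (V : lmodType A) (Z B : V -> Prop) :
  @noeth A A^o (fun=> True) (eq^~ 0) -> is_submod Z -> is_submod B ->
  (forall v, B v -> Z v) -> noeth Z B ->
  exists l : list {pred A}, forall p, assq Z B p -> List.In p l.
Proof.
move=> hA hZ hB BZ hN.
pose P S := [/\ is_submod S, forall v, S v -> Z v, forall v, B v -> S v &
  exists l : list {pred A}, forall p, assq S B p -> List.In p l].
have [||S [[hS SZ BS [l hl]] Smax]] := noeth_max (P := P) (S0 := B) hB hN.
- split=> //; exists [::] => p [[_ p1 _] _ [z Bz hz]].
  by move/negP: p1; case; apply/hz; rewrite scale1r.
- by move=> S [].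
have [[z Zz nSz]|ZS] := pselect (exists2 z, Z z & ~ S z); last first.
  exists l => p [ip pp [z Zz hz]]; apply: hl; split=> //; exists z => //.
  by apply: contrapT => nSz; apply: ZS; exists z.
have [p [ip pp [y Zy hy]]] := exists_assq hA hZ hS (ex_intro2 _ _ z Zz nSz).
(* S' = S + A y, and S'/S is isomorphic to A/p. *)
pose S' v := exists a u, S u /\ v = a *: y + u.
have hS' : is_submod S'.
  split; first by exists 0, 0; rewrite scale0r addr0; split=> //; apply: submod0.
  move=> a _ _ [b [u [Su ->]]] [c [v [Sv ->]]]; exists (a * b + c), (a *: u + v).
  by split; [apply: (proj2 hS) | rewrite scalerDr scalerDl scalerA addrACA].
have SS' v : S v -> S' v by exists 0, v; rewrite scale0r add0r.
have nSy : ~ S y.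
  by move=> Sy; case: ip => _ /negP p1 _; apply: p1; apply/hy; rewrite scale1r.
exfalso; apply: nSy; apply: (Smax S') => //; last first.
  by exists 1, 0; rewrite scale1r addr0; split=> //; apply: submod0.
split=> //.
- by move=> _ [a [u [Su ->]]]; apply: (proj2 hZ) => //; apply: SZ.
- by move=> v /BS/SS'.
exists (p :: l) => q Aq.
have : assq S B q \/ assq S' S q.
  apply: (@assq_ext _ V V V S B S' B S' S id id) Aq => //.
  by move=> v _ Sv; exists v; rewrite subrr; split=> //; apply: submod0.
case=> [/hl|]; first by right.
(* Every nonzero class of A/p has annihilator p; here c lies outside p because q is proper. *)
case=> iq pq [_ [c [u [Su ->]]] hq]; left; apply: funext => a; apply/idP/idP.
  move=> ap; apply/hq; rewrite scalerDr; apply: submodD => //; last exact: submodZ.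
  rewrite scalerA mulrC -scalerA; apply: submodZ => //; exact/hy.
move=> /hq; rewrite scalerDr => Sau.
have /hy/pp/orP[//|cp] : S ((a * c) *: y).
  rewrite -scalerA; apply: (submod_subr (v := - (a *: u)) hS).
    by rewrite opprK.
  by apply: submodN => //; apply: submodZ.
case: iq => _ /negP q1 _; case: q1; apply/hq; rewrite scale1r.
by apply: submodD => //; apply/hy.
Qed.

(** An element of [l] leaves the decreasing family at most once; past the last departure nothing
    changes. *)
Lemma decreasing_stable (T : Type) (l : list T) (F : nat -> T -> Prop) :
  (forall n x, F n x -> List.In x l) -> (forall n x, F n.+1 x -> F n x) ->
  exists N, forall n x, (N <= n)%N -> F n x <-> F N x.
Proof.
move=> Fl Fdec.
have Fmono m n x : (m <= n)%N -> F n x -> F m x.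
  by move=> /subnK <-; elim: (n - m)%N => // k IH; rewrite addSn => /Fdec.
suff [N hN] : exists N, forall x, List.In x l -> forall n, (N <= n)%N -> F n x <-> F N x.
  exists N => n x Nn; have [xl|xl] := pselect (List.In x l); first exact: hN.
  by split=> /Fl.
elim: l {Fl} => [|y l [N IH]]; first by exists 0%N.
have [[m nFm]|allF] := pselect (exists m, ~ F m y); last first.
  exists N => x [<- n _|]; last exact: IH.
  have FF k : F k y by apply: contrapT => nF; apply: allF; exists k.
  by split.
exists (maxn m N) => x [<- n mn|xl n mn].
  split=> [/(Fmono m)|/(Fmono m)]; last first.
    by move=> h; exfalso; apply/nFm/h/leq_maxl.
  by move=> h; exfalso; apply/nFm/h; apply: leq_trans mn; apply: leq_maxl.
rewrite (IH x xl n) ?(IH x xl (maxn m N)) ?leq_maxr //.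
by apply: leq_trans mn; apply: leq_maxr.
Qed.

(** * Iterated mapping cones *)

Section Cones.
Variables (R0 : comNzRingType) (R : comAlgType R0) (R1 : {pred R}).

(* [D k n] is the part of cohomological degree [k] and internal degree [n]. *)
Record complex (V : lmodType R) (d : V -> V) (D : int -> int -> V -> Prop)
    : Prop := Complex {
  cx_lin : forall a u v, d (a *: u + v) = a *: d u + d v;
  cx_dd : forall v, d (d v) = 0;
  cx_sub : forall k n, @is_submod R0 (restr_scalars V) (D k n);
  cx_d : forall k n v, D k n v -> D (k + 1) n (d v);
  cx_deg1 : forall x k n v, x \in R1 -> D k n v -> D k (n + 1) (x *: v)
}.

Definition cyc (V : lmodType R) (d : V -> V) (D : int -> int -> V -> Prop)
  k n (v : V) : Prop := D k n v /\ d v = 0.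

Definition bnd (V : lmodType R) (d : V -> V) (D : int -> int -> V -> Prop)
  k n (v : V) : Prop := exists2 w, D (k - 1) n w & v = d w.

(** The minus sign makes the square vanish, since x commutes with d. *)
Definition cone_d (V : lmodType R) (d : V -> V) (x : R) (p : V * V) : V * V :=
  (d p.1, x *: p.1 - d p.2).

(* The second factor is shifted so that the cone of a complex in degrees
   [>= 0] is again in degrees [>= 0]. *)
Definition cone_D (V : lmodType R) (D : int -> int -> V -> Prop)
  k n (p : V * V) : Prop := D k n p.1 /\ D (k - 1) (n + 1) p.2.

Definition coh_zero (V : lmodType R) (d : V -> V) D k n : Prop :=
  forall v, cyc d D k n v -> bnd d D k n v.

Definition coh_noeth (V : lmodType R) (d : V -> V) D k n : Prop :=
  @noeth R0 (restr_scalars V) (cyc d D k n) (bnd d D k n).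

Section OneComplex.
Variables (V : lmodType R) (d : V -> V) (D : int -> int -> V -> Prop).
Hypothesis hX : complex d D.

Lemma d0 : d 0 = 0.
Proof. by have := cx_lin hX (-1) 0 0; rewrite scaler0 addr0 scaleN1r addNr. Qed.
Lemma dD u v : d (u + v) = d u + d v.
Proof. by rewrite -[u]scale1r (cx_lin hX) !scale1r. Qed.
Lemma dZ a u : d (a *: u) = a *: d u.
Proof. by rewrite -[_ *: _]addr0 (cx_lin hX) d0 addr0. Qed.
Lemma dN u : d (- u) = - d u.
Proof. by rewrite -scaleN1r dZ scaleN1r. Qed.
Lemma dB u v : d (u - v) = d u - d v.
Proof. by rewrite dD dN. Qed.

Lemma D0 k n : D k n 0. Proof. exact: (submod0 (cx_sub hX k n)). Qed.
Lemma DD k n u v : D k n u -> D k n v -> D k n (u + v).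
Proof. exact: (submodD (cx_sub hX k n)). Qed.
Lemma DN k n u : D k n u -> D k n (- u).
Proof. exact: (submodN (cx_sub hX k n)). Qed.
Lemma DB k n u v : D k n u -> D k n v -> D k n (u - v).
Proof. exact: (submodB (cx_sub hX k n)). Qed.
Lemma D_d k n w : D (k - 1) n w -> D k n (d w).
Proof. by move=> /(cx_d hX); rewrite subrK. Qed.

Lemma cyc_submod k n : @is_submod R0 (restr_scalars V) (cyc d D k n).
Proof.
split; first by split; [apply: D0 | apply: d0].
move=> a u v [Du du] [Dv dv]; split; first exact: (proj2 (cx_sub hX k n)).
by rewrite [d _](cx_lin hX) du dv scaler0 addr0.
Qed.

Lemma bnd_submod k n : @is_submod R0 (restr_scalars V) (bnd d D k n).
Proof.
split; first by exists 0; [apply: D0 | rewrite d0].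
move=> a _ _ [u Du ->] [v Dv ->]; exists (a%:A *: u + v).
  exact: (proj2 (cx_sub hX (k - 1) n)).
by rewrite (cx_lin hX).
Qed.

Lemma bnd_cyc k n v : bnd d D k n v -> cyc d D k n v.
Proof. by move=> [w Dw ->]; split; [apply: D_d | apply: (cx_dd hX)]. Qed.

Lemma coh_zero_noeth k n : coh_zero d D k n -> coh_noeth d D k n.
Proof. exact: (@noeth_triv R0 (restr_scalars V)). Qed.

Lemma coh_zero_assq k n p :
  coh_zero d D k n -> ~ @assq R0 (restr_scalars V) (cyc d D k n) (bnd d D k n) p.
Proof.
move=> h0 [[_ /negP p1 _] _ [z Zz hz]]; apply: p1; apply/hz.
by rewrite scale1r; apply: h0.
Qed.

Variables (x : R).
Hypothesis R1x : x \in R1.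
Local Notation cd := (cone_d d x).
Local Notation cD := (cone_D D).

Lemma complex_cone : complex cd cD.
Proof.
split.
- move=> a [u1 u2] [v1 v2]; congr pair; rewrite /= !(cx_lin hX) // scalerDr.
  by rewrite scalerBr opprD addrACA !scalerA [x * a]mulrC.
- move=> [u v]; rewrite /cone_d /= dB !(cx_dd hX) subr0 dZ subrr; by [].
- move=> k n; split; first by split; apply: D0.
  by move=> a [u1 u2] [v1 v2] [? ?] [? ?]; split; apply: (proj2 (cx_sub hX _ _)).
- move=> k n [u v] [/= Du Dv]; split=> /=; first exact: (cx_d hX).
  rewrite addrK; apply: DB; first exact: (cx_deg1 hX).
  exact: D_d.
- by move=> y k n [u v] yR [Du Dv]; split; apply: (cx_deg1 hX).
Qed.

Lemma cone_cyc k n a b :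
  cyc cd cD k n (a, b) <-> [/\ cyc d D k n a, D (k - 1) (n + 1) b & x *: a = d b].
Proof.
split=> [[[/= Da Db] [da /eqP xa]]|[[Da da] Db e]]; last first.
  by split=> //; rewrite /cone_d /= da e subrr.
by split=> //; apply/eqP; rewrite -subr_eq0.
Qed.

Lemma cone_bnd_snd k n b :
  bnd d D (k - 1) (n + 1) b -> bnd cd cD k n (0, b).
Proof.
move=> [w Dw ->]; exists (0, - w); last by rewrite /cone_d /= d0 scaler0 dN opprK add0r.
by split; [apply: D0 | apply: DN].
Qed.

Lemma cone_bnd_fst k n p : bnd cd cD k n p -> bnd d D k n p.1.
Proof. by move=> [[w w'] [/= Dw _] ->]; exists w. Qed.

(** Exactness of H^(k-1)(X)_(n+1) -> H^k(cone)_n -> H^k(X)_n in the middle: if a = d w, subtracting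
    the boundary of (w, 0) leaves (0, b - x w). *)
Lemma cone_reduce k n a b :
  cyc cd cD k n (a, b) -> bnd d D k n a ->
  exists2 z, cyc d D (k - 1) (n + 1) z & bnd cd cD k n ((a, b) - (0, z)).
Proof.
move=> /cone_cyc[[Da da] Db e] [w Dw ew]; exists (b - x *: w).
  split; first by apply: DB => //; apply: (cx_deg1 hX).
  by rewrite dB dZ -ew e subrr.
exists (w, 0); first by split=> //; apply: D0.
by rewrite /cone_d /= d0 subr0 ew; congr pair; rewrite /= ?subr0 // subKr.
Qed.

End OneComplex.

Section ConeCohomology.
Variables (V : lmodType R) (d : V -> V) (D : int -> int -> V -> Prop).
Variables (x : R).
Hypotheses (hX : complex d D) (R1x : x \in R1).
Local Notation cd := (cone_d d x).
Local Notation cD := (cone_D D).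

Lemma cone_coh_zero k n :
  coh_zero d D k n -> coh_zero d D (k - 1) (n + 1) -> coh_zero cd cD k n.
Proof.
move=> h h' [a b] hab; have /h Ba : cyc d D k n a by case/cone_cyc: hab.
have [z /h'/(cone_bnd_snd hX x) Bz Bab] := cone_reduce hX R1x hab Ba.
by rewrite -(subrK (0, z) (a, b)); apply: (submodD (bnd_submod (complex_cone hX R1x) k n)).
Qed.

Lemma cone_coh_noeth k n :
  coh_noeth d D k n -> coh_noeth d D (k - 1) (n + 1) -> coh_noeth cd cD k n.
Proof.
move=> h h'.
apply: (@noeth_ext R0 (restr_scalars V) (restr_scalars (V * V)%type) (restr_scalars V)
  _ _ _ _ _ _ (fun b => (0, b)) fst _ _ (cyc_submod hX _ _)
  (bnd_submod (complex_cone hX R1x) k n) _ _ _ h' h) => //.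
- by move=> a u v; congr pair; rewrite /= scaler0 addr0.
- by move=> b; apply: cone_bnd_snd.
- by move=> [a b] /cone_cyc[].
- by move=> [a b] hab Ba; have [z] := cone_reduce hX R1x hab Ba; exists z.
Qed.

Lemma cone_fst_exact k n v :
  cyc d D k n v -> bnd d D k (n + 1) (x *: v) -> exists b, cyc cd cD k n (v, b).
Proof.
by move=> cv [w Dw ew]; exists w; apply/cone_cyc; split=> //.
Qed.

Lemma cyc_deg1 k n v : cyc d D k n v -> cyc d D k (n + 1) (x *: v).
Proof.
by move=> [Dv dv]; split; [apply: (cx_deg1 hX) | rewrite (dZ hX) dv scaler0].
Qed.

Lemma bnd_deg1 k n v : bnd d D k n v -> bnd d D k (n + 1) (x *: v).
Proof.
move=> [w Dw ->]; exists (x *: w); first exact: (cx_deg1 hX).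
by rewrite (dZ hX).
Qed.

Lemma scale_alg (a : R0) (v : V) : x *: (a%:A *: v) = a%:A *: (x *: v).
Proof. by rewrite !scalerA mulrC. Qed.

(** Uses H^k(cone)_n -> H^k(X)_n -> H^k(X)_(n+1), whose exactness is [cone_fst_exact]. Knowledge in
    degree n + 1 yields knowledge in degree n. *)
Lemma coh_noeth_cone k n :
  coh_noeth cd cD k n -> coh_noeth d D k (n + 1) -> coh_noeth d D k n.
Proof.
move=> h h'.
apply: (@noeth_ext R0 (restr_scalars (V * V)%type) (restr_scalars V) (restr_scalars V)
  _ _ _ _ _ _ fst (fun v => x *: (v : V)) _ _
  (cyc_submod (complex_cone hX R1x) _ _) (bnd_submod hX k n) _ _ _ h h') => //.
- by move=> a u v; rewrite scalerDr; congr (_ + _); apply: scale_alg.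
- by move=> p; apply: cone_bnd_fst.
- by move=> v; apply: cyc_deg1.
move=> v cv /(cone_fst_exact cv)[b cvb]; exists (v, b); split=> //.
by rewrite subrr; apply: (submod0 (bnd_submod hX k n)).
Qed.

Section AssociatedPrimes.
Variables (k n : int) (p : {pred R0}).
Hypothesis h0 : coh_zero d D (k - 1) (n + 1).
Local Notation assX m := (@assq R0 (restr_scalars V) (cyc d D k m) (bnd d D k m) p).
Local Notation assC :=
  (@assq R0 (restr_scalars (V * V)%type) (cyc cd cD k n) (bnd cd cD k n) p).

(** [h0] kills the term to the left of H^k(cone)_n, so the first projection is injective on
    cohomology. *)
Let fst_bnd z : cyc cd cD k n z -> bnd cd cD k n z <-> bnd d D k n z.1.
Proof.
case: z => a b hab; split; first exact: cone_bnd_fst.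
move=> /= Ba; have [z /h0/(cone_bnd_snd hX x) Bz Bab] := cone_reduce hX R1x hab Ba.
rewrite -(subrK (0, z) (a, b)).
exact: (submodD (bnd_submod (complex_cone hX R1x) k n)).
Qed.

Lemma assq_cone_sub : assC -> assX n.
Proof.
apply: (@assq_sub R0 (restr_scalars (V * V)%type) (restr_scalars V)
  _ _ _ _ fst _ _ _ (cyc_submod (complex_cone hX R1x) _ _)) => //.
by move=> [a b] /cone_cyc[].
Qed.

Lemma assq_cone_ext : assX n -> assC \/ assX (n + 1).
Proof.
apply: (@assq_ext R0 (restr_scalars (V * V)%type) (restr_scalars V) (restr_scalars V)
  _ _ _ _ _ _ fst (fun v => x *: (v : V)) _ _ _ (cyc_submod hX _ _)
  (bnd_submod hX _ _) (cyc_submod (complex_cone hX R1x) _ _)) => //.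
- exact: scale_alg.
- by move=> v; apply: cyc_deg1.
- by move=> v; apply: bnd_deg1.
move=> v cv /(cone_fst_exact cv)[b cvb]; exists (v, b); split=> //.
by rewrite subrr; apply: (submod0 (bnd_submod hX k n)).
Qed.
End AssociatedPrimes.

End ConeCohomology.

(* The iterated cone along [s] is the Koszul complex on [s]. *)
Fixpoint koszul_good (s : seq R) (V : lmodType R) (d : V -> V)
    (D : int -> int -> V -> Prop) : Prop :=
  match s with
  | [::] => (forall k, exists N, forall n, n <= N -> coh_zero d D k n) /\
            forall k n, coh_noeth d D k n
  | x :: s' => koszul_good s' (cone_d d x) (cone_D D)
  end.

(** The path from condition (a) to finiteness. Vanishing in high degrees passes up to the cones;
    finiteness passes back down, one internal degree at a time from the bound [N]. *)
Lemma koszul_coh_noeth (s : seq R) (V : lmodType R) (d : V -> V) D :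
  {subset s <= R1} -> complex d D -> koszul_good s d D ->
  (forall k, exists N, forall n, N <= n -> coh_zero d D k n) ->
  forall k n, coh_noeth d D k n.
Proof.
elim: s V d D => [|x s IH] V d D sR hX /=; first by case.
have R1x : x \in R1 by apply: sR; rewrite mem_head.
move=> good van.
have hN : forall k n, coh_noeth (cone_d d x) (cone_D D) k n.
  apply: IH => //; first by move=> y ys; apply: sR; rewrite inE ys orbT.
    exact: complex_cone.
  move=> k; have [N hN] := van k; have [N' hN'] := van (k - 1).
  exists (Num.max N N') => n; rewrite ge_max => /andP[Nn N'n].
  by apply: cone_coh_zero => //; [apply: hN | apply: hN'; lia].
move=> k n; have [N van_k] := van k.
have [Nn|nN] := leP N n; first exact/coh_zero_noeth/van_k.
have [m ->] : exists m : nat, n = N - m%:Z by exists `|N - n|%N; lia.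
elim: m {n nN} => [|m IHm]; first by apply/coh_zero_noeth/van_k; lia.
apply: (coh_noeth_cone hX R1x) => //.
by have -> : N - m.+1%:Z + 1 = N - m%:Z by lia.
Qed.

Lemma koszul_assq_stable (s : seq R) (V : lmodType R) (d : V -> V) D (i : int) :
  @noeth R0 R0^o (fun=> True) (eq^~ 0) ->
  {subset s <= R1} -> complex d D -> koszul_good s d D ->
  (forall k n, coh_noeth d D k n) ->
  (forall j, j < i -> exists N, forall n, n <= N -> coh_zero d D j n) ->
  exists N, forall n p, n <= N ->
    @assq R0 (restr_scalars V) (cyc d D i n) (bnd d D i n) p <->
    @assq R0 (restr_scalars V) (cyc d D i N) (bnd d D i N) p.
Proof.
move=> hR0; elim: s V d D => [|x s IH] V d D sR hX /=.
  move=> [van _] _ _; have [N hN] := van i.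
  by exists N => n p nN; split=> /coh_zero_assq []; apply: hN.
have R1x : x \in R1 by apply: sR; rewrite mem_head.
move=> good hN van.
have [|||N0 stab] := IH _ _ _ _ (complex_cone hX R1x) good.
- by move=> y ys; apply: sR; rewrite inE ys orbT.
- by move=> k n; apply: cone_coh_noeth.
- move=> j ji; have [N hj] := van j ji; have [|N' hj'] := van (j - 1); first by lia.
  exists (Num.min N (N' - 1)) => n; rewrite le_min => /andP[nN nN'].
  by apply: cone_coh_zero => //; [apply: hj | apply: hj'; lia].
have [|N1 van1] := van (i - 1); first by lia.
(* For n <= N the cone is stable in degree n and H^(i-1) vanishes in degree n + 1, where the cone
   shift puts it. *)
pose N := Num.min N0 (N1 - 1).
have [NN0 NN1] : N <= N0 /\ N <= N1 - 1 by rewrite /N; lia.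
pose F (m : nat) p := @assq R0 (restr_scalars V)
  (cyc d D i (N - m%:Z)) (bnd d D i (N - m%:Z)) p.
have [l hl] := assq_finite hR0 (cyc_submod hX i N) (bnd_submod hX i N)
  (@bnd_cyc V d D hX i N) (hN i N).
(* A prime of degree N - m - 1 is either already one of degree N - m, or belongs to the cone; cone
   primes do not depend on the degree here, and those of degree N - m embed into [F m]. *)
have dec m p : F m.+1 p -> F m p.
  rewrite /F; have e : N - m%:Z = N - m.+1%:Z + 1 by lia.
  move=> /(assq_cone_ext hX R1x)[]; last by rewrite -e.
    by apply: van1; lia.
  rewrite (stab (N - m.+1%:Z)); last by lia.
  rewrite -(stab (N - m%:Z)); last by lia.
  by apply: (assq_cone_sub hX R1x); apply: van1; lia.
have Fl m p : F m p -> List.In p l.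
  move=> Fp; apply: hl; elim: m Fp => [|m IHm /dec//]; by rewrite /F subr0.
have [M hM] := decreasing_stable Fl dec.
exists (N - M%:Z) => n p nM.
have [m en] : exists m : nat, n = N - m%:Z by exists `|N - n|%N; lia.
rewrite {}en in nM *; have Mm : (M <= m)%N by lia.
exact: (hM m p Mm).
Qed.

(** * Comparison of subcomplexes *)

(* [acyc D D'] says that the quotient complex [D' / D] is acyclic. *)
Definition acyc (V : lmodType R) (d : V -> V) (D D' : int -> int -> V -> Prop) :=
  forall k n v, D' k n v -> D (k + 1) n (d v) ->
    exists2 w, D' (k - 1) n w & D k n (v - d w).

Section Comparison.
Variables (V : lmodType R) (d : V -> V) (D D' : int -> int -> V -> Prop).
Hypotheses (hX : complex d D) (hX' : complex d D').
Hypothesis DD' : forall k n v, D k n v -> D' k n v.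

(** Surjectivity of H(D) -> H(D'); injectivity is [acyc_bnd]. *)
Lemma acyc_cyc k n z : acyc d D D' -> cyc d D' k n z ->
  exists2 z', cyc d D k n z' & bnd d D' k n (z - z').
Proof.
move=> ac [Dz dz]; have [|w Dw Dzw] := ac k n z Dz; first by rewrite dz; apply: (D0 hX).
exists (z - d w); last by exists w => //; rewrite subKr.
by split=> //; rewrite (dB hX) dz (cx_dd hX) subrr.
Qed.

Lemma acyc_bnd k n z : acyc d D D' -> cyc d D k n z -> bnd d D' k n z -> bnd d D k n z.
Proof.
move=> ac [Dz dz] [w Dw ew]; have [|u Du Dwu] := ac (k - 1) n w Dw.
  by rewrite subrK -ew.
by exists (w - d u) => //; rewrite (dB hX) (cx_dd hX) subr0.
Qed.

Lemma bnd_mono k n z : bnd d D k n z -> bnd d D' k n z.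
Proof. by move=> [w /DD' Dw ->]; exists w. Qed.

Lemma cyc_mono k n z : cyc d D k n z -> cyc d D' k n z.
Proof. by move=> [/DD' Dz dz]. Qed.

Lemma acyc_coh_zero k n : acyc d D D' -> coh_zero d D k n <-> coh_zero d D' k n.
Proof.
move=> ac; split=> h z cz; last first.
  by apply: acyc_bnd => //; apply/h/cyc_mono.
have [z' /h/bnd_mono Bz' Bzz'] := acyc_cyc ac cz.
by rewrite -(subrK z' z); apply: (submodD (bnd_submod hX' k n)).
Qed.

Lemma acyc_coh_noeth k n : acyc d D D' -> coh_noeth d D k n <-> coh_noeth d D' k n.
Proof.
move=> ac; split.
  apply: (@noeth_surj R0 (restr_scalars V) (restr_scalars V) _ _ _ _ id) => //.
  - exact: cyc_submod.
  - exact: bnd_submod.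
  - by move=> v; apply: bnd_mono.
  - by move=> v cv; have [z'] := acyc_cyc ac cv; exists z'.
apply: (@noeth_inj R0 (restr_scalars V) (restr_scalars V) _ _ _ _ id) => //.
- exact: bnd_submod.
- by move=> v; apply: cyc_mono.
- by move=> v; apply: acyc_bnd.
Qed.

Variable x : R.
Hypothesis R1x : x \in R1.

Lemma cone_mono k n v : cone_D D k n v -> cone_D D' k n v.
Proof. by move=> [/DD' ? /DD' ?]. Qed.

(** Correct the first coordinate by [w]; then b - x w is a cycle modulo [D] and is corrected by
    [u]. *)
Lemma acyc_cone : acyc d D D' -> acyc (cone_d d x) (cone_D D) (cone_D D').
Proof.
move=> ac k n [a b] [/= Da Db] [/= Dda Dxb]; rewrite addrK in Dxb.
have [w Dw Daw] := ac k n a Da Dda.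
have [||u Du Dbu] := ac (k - 1) (n + 1) (b - x *: w).
- by apply: (DB hX') => //; apply: (cx_deg1 hX').
- rewrite subrK -[d _]opprK; apply: (DN hX).
  have -> : - d (b - x *: w) = x *: a - d b - x *: (a - d w).
    by rewrite (dB hX) (dZ hX) scalerBr !opprB [RHS]addrC addrA subrK.
  by apply: (DB hX) => //; apply: (cx_deg1 hX).
exists (w, - u); first by split=> //; apply: (DN hX').
by split=> //=; rewrite (dN hX) opprK opprD addrA.
Qed.

(** Bijectivity of y from degree n to degree n + 1 of the quotient D'/D. *)
Definition bij_mod (y : R) : Prop :=
  (forall k n v, D' k n v -> D k (n + 1) (y *: v) -> D k n v) /\
  (forall k n v, D' k (n + 1) v -> exists2 w, D' k n w & D k (n + 1) (v - y *: w)).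

(** The cone of an isomorphism is acyclic, applied to x on D'/D. *)
Lemma acyc_cone_bij : bij_mod x -> acyc (cone_d d x) (cone_D D) (cone_D D').
Proof.
move=> [inj surj] k n [a b] [/= Da Db] [/= Dda Dxb]; rewrite addrK in Dxb.
have [w Dw Dbw] := surj _ _ _ Db.
exists (w, 0); first by split=> //; apply: (D0 hX').
split=> /=; last by rewrite (d0 hX) subr0.
apply: inj; first by apply: (DB hX') => //; apply: (D_d hX').
have -> : x *: (a - d w) = (x *: a - d b) + d (b - x *: w).
  by rewrite (dB hX) (dZ hX) scalerBr addrA subrK.
by apply: (DD hX) => //; apply: (D_d hX).
Qed.
End Comparison.

Lemma koszul_good_acyc (s : seq R) (V : lmodType R) (d : V -> V) D D' :
  {subset s <= R1} -> complex d D -> complex d D' ->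
  (forall k n v, D k n v -> D' k n v) -> acyc d D D' ->
  koszul_good s d D <-> koszul_good s d D'.
Proof.
elim: s V d D D' => [|x s IH] V d D D' sR hX hX' DD' ac /=.
  split=> -[h1 h2]; split.
  - by move=> k; have [N hN] := h1 k; exists N => n /hN; rewrite (acyc_coh_zero hX hX').
  - by move=> k n; rewrite -(acyc_coh_noeth hX hX').
  - by move=> k; have [N hN] := h1 k; exists N => n /hN; rewrite -(acyc_coh_zero hX hX').
  - by move=> k n; rewrite (acyc_coh_noeth hX hX').
have R1x : x \in R1 by apply: sR; rewrite mem_head.
apply: IH; try exact: complex_cone.
- by move=> y ys; apply: sR; rewrite inE ys orbT.
- exact: cone_mono.
- exact: acyc_cone.
Qed.

(** Bijectivity of x survives cones on the other elements, coordinate by coordinate. Once x itself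
    is reached, the quotient becomes acyclic and [koszul_good_acyc] takes over. *)
Lemma koszul_good_bij (x : R) (s : seq R) (V : lmodType R) (d : V -> V) D D' :
  {subset s <= R1} -> x \in s -> complex d D -> complex d D' ->
  (forall k n v, D k n v -> D' k n v) -> bij_mod D D' x ->
  koszul_good s d D <-> koszul_good s d D'.
Proof.
elim: s V d D D' => [//|y s IH] V d D D' sR xs hX hX' DD' bij /=.
have R1y : y \in R1 by apply: sR; rewrite mem_head.
have sR' : {subset s <= R1} by move=> z zs; apply: sR; rewrite inE zs orbT.
have [xy|nxy] := eqVneq x y.
  rewrite xy in bij; apply: koszul_good_acyc => //; try exact: complex_cone.
    exact: cone_mono.
  exact: acyc_cone_bij.
apply: IH => //; try exact: complex_cone.
- by move: xs; rewrite inE (negPf nxy).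
- exact: cone_mono.
case: bij => inj surj; split.
  by move=> k n [a b] [Da Db] [Dxa Dxb]; split; apply: inj.
move=> k n [a b] [/surj[w Dw Daw] /surj[w' Dw' Dbw']].
by exists (w, w').
Qed.

(** Already the components of the complex, before taking cohomology, are finite and vanish in low
    degrees, and cones inherit both properties. *)
Lemma koszul_good_finite (s : seq R) (V : lmodType R) (d : V -> V) D :
  {subset s <= R1} -> complex d D ->
  (forall k, exists N, forall n, n <= N -> forall v, D k n v -> v = 0) ->
  (forall k n, @noeth R0 (restr_scalars V) (D k n) (eq^~ 0)) ->
  koszul_good s d D.
Proof.
elim: s V d D => [|x s IH] V d D sR hX van hN /=.
  split=> [k|k n].
    have [N hk] := van k; exists N => n nN v [/(hk n nN) -> _].
    exact: (submod0 (bnd_submod hX k n)).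
  apply: (@noeth_surj R0 (restr_scalars V) (restr_scalars V) _ _ _ _ id) (hN k n) => //.
  - exact: (cx_sub hX).
  - exact: bnd_submod.
  - by move=> _ ->; apply: (submod0 (bnd_submod hX k n)).
  - by move=> v [Dv _]; exists v; rewrite subrr; split=> //; apply: (submod0 (bnd_submod hX k n)).
have R1x : x \in R1 by apply: sR; rewrite mem_head.
apply: IH; first by move=> y ys; apply: sR; rewrite inE ys orbT.
- exact: complex_cone.
- move=> k; have [N hk] := van k; have [N' hk'] := van (k - 1).
  exists (Num.min N (N' - 1)) => n nN [a b] [/= Da Db]; congr pair.
    by apply: (hk n) => //; lia.
  by apply: (hk' (n + 1)) => //; lia.
move=> k n.
apply: (@noeth_ext R0 (restr_scalars V) (restr_scalars (V * V)%type) (restr_scalars V)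
  (D (k - 1) (n + 1)) (eq^~ 0) _ _ (D k n) (eq^~ 0) (fun b => (0, b)) fst) => //.
- by move=> a u v; congr pair; rewrite /= scaler0 addr0.
- exact: (cx_sub hX).
- exact: is_submod1.
- by move=> _ ->.
- by move=> v [].
move=> [a b] [/= _ Db] ->; exists b; split=> //.
by rewrite -[LHS]/((0, b) - (0, b) : V * V) subrr.
Qed.

End Cones.

(** * Homogeneous components *)

Record components (K : eqType) (V : zmodType) (D : K -> {pred V})
    (c : K -> V -> V) : Prop := Components {
  cp_mem : forall n v, c n v \in D n;
  cp_add : forall n u v, c n (u + v) = c n u + c n v;
  cp_id : forall n v, v \in D n -> c n v = v;
  cp_ne : forall m n v, v \in D n -> m != n -> c m v = 0;
  cp_sum : forall v, exists s : seq K,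
    [/\ uniq s, v = \sum_(n <- s) c n v & forall n, n \notin s -> c n v = 0]
}.

Section Components.
Variables (K : eqType) (V : zmodType) (D : K -> {pred V}).
Hypothesis hD : grading D.

Lemma grading0 n : 0 \in D n.
Proof. by case: hD => h _ _; case: (h n). Qed.
Lemma gradingB n u v : u \in D n -> v \in D n -> u - v \in D n.
Proof. by case: hD => h _ _; case: (h n) => _; apply. Qed.
Lemma gradingN n u : u \in D n -> - u \in D n.
Proof. by move=> Du; rewrite -sub0r; apply: gradingB => //; apply: grading0. Qed.
Lemma gradingD n u v : u \in D n -> v \in D n -> u + v \in D n.
Proof. by move=> Du Dv; rewrite -[v]opprK; apply: gradingB => //; apply: gradingN. Qed.
Let decomp (v : V) (f : K -> V) : Prop := (forall n, f n \in D n) /\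
  exists s : seq K, [/\ uniq s, v = \sum_(n <- s) f n & forall n, n \notin s -> f n = 0].

Let sum_wider (s t : seq K) (f : K -> V) : uniq s -> uniq t -> {subset s <= t} ->
  (forall n, n \notin s -> f n = 0) -> \sum_(n <- t) f n = \sum_(n <- s) f n.
Proof.
move=> us ut st f0; rewrite (bigID (mem s)) /= [X in _ + X]big1; last exact: f0.
rewrite addr0 -big_filter; apply: perm_big; apply: uniq_perm => //.
  exact: filter_uniq.
by move=> n; rewrite mem_filter; case ns: (n \in s) => //=; apply: st.
Qed.

Let decompB u v f g : decomp u f -> decomp v g -> decomp (u - v) (fun n => f n - g n).
Proof.
move=> [Df [s [us -> f0]]] [Dg [t [ut -> g0]]]; split.
  by move=> n; apply: gradingB.
exists (undup (s ++ t)); split; first exact: undup_uniq.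
  rewrite sumrB (sum_wider us _ _ f0) ?undup_uniq //; last first.
    by move=> n ns; rewrite mem_undup mem_cat ns.
  rewrite (sum_wider ut _ _ g0) ?undup_uniq //.
  by move=> n ns; rewrite mem_undup mem_cat ns orbT.
move=> n; rewrite mem_undup mem_cat negb_or => /andP[ns nt].
by rewrite f0 // g0 // subrr.
Qed.

Let decomp0 f : decomp 0 f -> forall n, f n = 0.
Proof.
move=> [Df [s [us s0 f0]]] n; have [ns|ns] := boolP (n \in s); last exact: f0.
by case: hD => _ _ h; apply: (h s f).
Qed.

Let decomp_uniq v f g : decomp v f -> decomp v g -> forall n, f n = g n.
Proof.
move=> df dg n; apply/eqP; rewrite -subr_eq0; apply/eqP.
by have := decompB df dg; rewrite subrr => /decomp0 /(_ n).
Qed.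

Let decomp_hom n v : v \in D n -> decomp v (fun m => if m == n then v else 0).
Proof.
move=> Dv; split.
  by move=> m; have [->|] := eqVneq m n => // _; apply: grading0.
exists [:: n]; split=> //; first by rewrite big_seq1 eqxx.
by move=> m; rewrite inE => /negPf ->.
Qed.

(** The sums in [grading] may repeat a degree, so the family is assembled by adding one homogeneous
    term at a time. *)
Let decomp_ex v : exists f, decomp v f.
Proof.
case: hD => _ ex _; have [s [f [Df ->]]] := ex v.
elim: s => [|n s [g dg]].
  exists (fun=> 0); split=> [n|]; first exact: grading0.
  by exists [::]; rewrite !big_nil.
rewrite big_cons; exists (fun m => (if m == n then f n else 0) - (0 - g m)).
rewrite -[X in _ + X]opprK -[- \sum_(_ <- _) _]sub0r; apply: decompB.
  exact: decomp_hom.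
apply: decompB => //; split=> [m|]; first exact: grading0.
by exists [::]; rewrite !big_nil.
Qed.

Lemma grading_components : exists c, components D c.
Proof.
have [c hc] := choice decomp_ex; exists (fun n v => c v n); split.
- by move=> n v; case: (hc v).
- move=> n u v; have /decomp_uniq := hc (u + v).
  have dv : decomp (- v) (fun n => 0 - c v n).
    rewrite -[- v]sub0r; apply: decompB => //; split=> [m|]; first exact: grading0.
    by exists [::]; rewrite !big_nil.
  have := decompB (hc u) dv; rewrite opprK => duv /(_ _ duv) ->.
  by rewrite sub0r opprK.
- by move=> n v /decomp_hom/(decomp_uniq (hc v))/(_ n) ->; rewrite eqxx.
- by move=> m n v /decomp_hom/(decomp_uniq (hc v))/(_ m) -> /negPf ->.
- by move=> v; case: (hc v).
Qed.

Definition comp : K -> V -> V := projT1 (cid grading_components).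

Lemma compP : components D comp.
Proof. exact: projT2 (cid grading_components). Qed.

Lemma comp_mem n v : comp n v \in D n. Proof. exact: cp_mem compP n v. Qed.
Lemma compD n u v : comp n (u + v) = comp n u + comp n v.
Proof. exact: cp_add compP n u v. Qed.
Lemma comp_id n v : v \in D n -> comp n v = v. Proof. exact: cp_id compP n v. Qed.
Lemma comp_ne m n v : v \in D n -> m != n -> comp m v = 0.
Proof. exact: cp_ne compP m n v. Qed.
Lemma comp_sum v : exists s : seq K,
  [/\ uniq s, v = \sum_(n <- s) comp n v & forall n, n \notin s -> comp n v = 0].
Proof. exact: cp_sum compP v. Qed.
Lemma comp0 n : comp n 0 = 0. Proof. by apply: comp_id; apply: grading0. Qed.
Lemma compN n v : comp n (- v) = - comp n v.
Proof. by apply/eqP; rewrite -addr_eq0 -compD addNr comp0. Qed.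
Lemma compB n u v : comp n (u - v) = comp n u - comp n v.
Proof. by rewrite compD compN. Qed.
Lemma comp_bigsum n I (r : seq I) (P : pred I) (F : I -> V) :
  comp n (\sum_(i <- r | P i) F i) = \sum_(i <- r | P i) comp n (F i).
Proof. exact: (big_morph (comp n) (compD n) (comp0 n)). Qed.

End Components.

(** Injectivity of [phi] keeps distinct components apart. Two index types let one lemma serve
    differentials, multiplication by a homogeneous scalar, and r -> r v from the ring to a
    module. *)
Lemma comp_map (K L : eqType) (V W : zmodType) (D : K -> {pred V}) (D' : L -> {pred W})
    (hD : grading D) (hD' : grading D') (f : V -> W) (phi : K -> L) :
  (forall u v, f (u + v) = f u + f v) -> injective phi ->
  (forall n v, v \in D n -> f v \in D' (phi n)) ->
  forall n v, comp hD' (phi n) (f v) = f (comp hD n v).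
Proof.
move=> fD phi_inj fD' n v.
have f0 : f 0 = 0 by apply: (addIr (f 0)); rewrite -fD !add0r.
have fsum (s : seq K) (g : K -> V) : f (\sum_(m <- s) g m) = \sum_(m <- s) f (g m).
  exact: (big_morph f fD f0).
have [s [us ev s0]] := comp_sum hD v.
rewrite [in LHS]ev fsum comp_bigsum.
have [ns|ns] := boolP (n \in s).
  rewrite (bigD1_seq n) //= (comp_id hD') ?big1 ?addr0 //; last first.
    by apply: fD'; apply: comp_mem.
  move=> m mn; apply: (comp_ne hD' (n := phi m)); first by apply: fD'; apply: comp_mem.
  by rewrite (inj_eq phi_inj) eq_sym.
rewrite (s0 n ns) f0 big1_seq // => m /= ms.
apply: (comp_ne hD' (n := phi m)); first by apply: fD'; apply: comp_mem.
by rewrite (inj_eq phi_inj); apply: contraNneq ns => ->.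
Qed.

(** * Finiteness over the base ring *)

Lemma fin_gen_span (A : comNzRingType) (V : lmodType A) (P : {pred V}) :
  fin_gen P -> exists s : seq V, {subset s <= P} /\ forall x, x \in P -> lspan s x.
Proof. by move=> [s [sP h]]; exists s; split=> // x /h/lspan_sum. Qed.

Lemma list_bound (T : eqType) (s : seq T) (P : T -> nat -> Prop) :
  (forall x m n, (m <= n)%N -> P x m -> P x n) ->
  (forall x, x \in s -> exists n, P x n) -> exists n, forall x, x \in s -> P x n.
Proof.
move=> Pmono; elim: s => [|x s IH] h; first by exists 0%N.
have [n hn] := h x (mem_head _ _).
have [|m hm] := IH; first by move=> y ys; apply: h; rewrite inE ys orbT.
exists (maxn n m) => y; rewrite inE => /orP[/eqP ->|/hm].
  by apply: Pmono hn; apply: leq_maxl.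
by apply: Pmono; apply: leq_maxr.
Qed.

Lemma noetherian_noeth (R : comNzRingType) :
  noetherian R -> @noeth R R^o (fun=> True) (eq^~ 0).
Proof.
move=> hR S hS _; pose I : {pred R^o} := fun x => `[< S x >].
have IE x : x \in I <-> S x by rewrite unfold_in /I; split=> /asboolP.
have [|s [sI sgen]] := @fin_gen_span _ R^o I (hR I _).
  split; first by apply/IE; apply: submod0.
  by move=> a u v /IE Su /IE Sv; apply/IE; apply: (proj2 hS).
exists s; split=> [x /sI/IE//|v /IE/sgen hv]; exists v; split=> //.
by rewrite subrr.
Qed.

Section StandardGraded.
Variables (R0 : comNzRingType) (R : comAlgType R0) (Rn : nat -> {pred R}).
Hypothesis hR : standard_graded Rn.
Hypothesis noethR : @noeth R R^o (fun=> True) (eq^~ 0).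

Local Notation hg := (sg_grading hR).

Lemma alg_deg0 (a : R0) : (a%:A : R) \in Rn 0%N.
Proof. by apply/(sg_base hR); exists a. Qed.

Lemma coef0_ex (r : R) : exists a : R0, comp hg 0%N r = a%:A.
Proof. by apply/(sg_base hR); apply: comp_mem. Qed.

Definition coef0 (r : R) : R0 := projT1 (cid (coef0_ex r)).

Lemma coef0P r : comp hg 0%N r = (coef0 r)%:A.
Proof. exact: projT2 (cid (coef0_ex r)). Qed.

(** An R_0-submodule S of one component is recovered from the R-module it generates: in a
    combination of elements of S with coefficients in R, only the degree 0 parts of the coefficients
    contribute to that component. *)
Lemma noeth_piece (K : eqType) (V : lmodType R) (D : K -> {pred V})
    (hD : grading D) (phi : nat -> K) (n : K) :
  injective phi -> phi 0%N = n ->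
  (forall m r v, r \in Rn m -> v \in D n -> r *: v \in D (phi m)) ->
  @noeth R V (fun=> True) (eq^~ 0) ->
  @noeth R0 (restr_scalars V) (fun v => v \in D n) (eq^~ 0).
Proof.
move=> phi_inj phi0 Dphi hN S hS SD.
pose T v := forall S' : V -> Prop, is_submod S' -> (forall x, S x -> S' x) -> S' v.
have hT : is_submod T.
  split=> [S' hS' _|a u v Tu Tv S' hS' SS']; first exact: submod0.
  by apply: (proj2 hS'); [apply: Tu|apply: Tv].
have [|s [sT sgen]] := hN T hT; first by [].
(* Generators of [T] need not lie in [S]; each is replaced by finitely many elements of [S] that
   span it. *)
have [t [tS st]] : exists t : seq V, (forall x, x \in t -> S x) /\
    forall x, x \in s -> lspan t x.
  elim: s sT {sgen} => [|x s IH] sT; first by exists [::].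
  have [t [tS st]] := IH (fun y ys => sT y (mem_behead (s := x :: s) ys)).
  have [t' [t'S xt]] : exists t' : seq V, (forall x, x \in t' -> S x) /\ lspan t' x.
    apply: (sT x (mem_head _ _) (fun x => exists t' : seq V,
      (forall x, x \in t' -> S x) /\ lspan t' x)); last first.
      move=> y Sy; exists [:: y]; split=> [z|]; first by rewrite inE => /eqP ->.
      by apply: lspan_mem; rewrite mem_head.
    split; first by exists [::]; split=> //; exact: (submod0 (lspan_submod _)).
    move=> a u v [tu [tuS su]] [tv [tvS sv]]; exists (tu ++ tv).
    split=> [y|]; first by rewrite mem_cat => /orP[/tuS|/tvS].
    apply: (proj2 (lspan_submod _)).
      by apply: lspan_min su => [|y yt]; [exact: lspan_submod|apply: lspan_mem; rewrite mem_cat yt].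
    by apply: lspan_min sv => [|y yt]; [exact: lspan_submod|apply: lspan_mem; rewrite mem_cat yt orbT].
  exists (t' ++ t); split=> [y|y]; first by rewrite mem_cat => /orP[/t'S|/tS].
  rewrite inE => /orP[/eqP ->|/st].
    by apply: lspan_min xt => [|z zt]; [exact: lspan_submod|apply: lspan_mem; rewrite mem_cat zt].
  by apply: lspan_min => [|z zt]; [exact: lspan_submod|apply: lspan_mem; rewrite mem_cat zt orbT].
exists t; split=> // v Sv; exists v; split; last by rewrite subrr.
have [|w [sw /eqP]] := sgen v; first by move=> S' _; apply.
rewrite subr_eq0 => /eqP evw; rewrite -evw {w evw} in sw.
have /lspan_sum[c ec] : lspan t v by apply: lspan_min sw => //; exact: lspan_submod.
apply/(@lspan_sum R0 (restr_scalars V)).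
exists (fun i => coef0 (c i)); rewrite -[LHS](comp_id hD (n := n)); last exact: SD.
rewrite [in LHS]ec comp_bigsum; apply: eq_bigr => i _.
have tD : t`_i \in D n by apply/SD/tS/mem_nth.
rewrite -phi0 (comp_map hg hD (f := fun r => r *: t`_i) (phi := phi)) //.
- by rewrite coef0P.
- by move=> u u'; rewrite scalerDl.
- by move=> m r rm; apply: Dphi.
Qed.

Lemma noethR0 : @noeth R0 R0^o (fun=> True) (eq^~ 0).
Proof.
have h : @noeth R0 (restr_scalars R^o) (fun v => v \in Rn 0%N) (eq^~ 0).
  apply: (@noeth_piece nat R^o Rn hg id 0%N) => // m r v rm v0.
  by have := sg_mul hR rm v0; rewrite addn0.
apply: (@noeth_inj R0 R0^o (restr_scalars R^o) _ _ _ _ (fun a => (a%:A : R))) h => //.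
- move=> a u v; rewrite -[a *: u]/(a * u) scalerDl; congr (_ + _).
  by rewrite -[RHS]/(a%:A * u%:A) -scalerAl mul1r scalerA.
- exact: is_submod1.
- by move=> v _; apply: alg_deg0.
- move=> v _ v0; apply: (sg_base_inj hR); by rewrite v0 scale0r.
Qed.

Lemma noeth_Rn n : @noeth R0 (restr_scalars R^o) (fun v => v \in Rn n) (eq^~ 0).
Proof.
apply: (@noeth_piece nat R^o Rn hg (fun m => (m + n)%N) n) => //.
- exact: addIn.
- by move=> m r v rm vn; apply: (sg_mul hR rm vn).
Qed.

Section GradedModule.
Variable M : grmod Rn.

Local Notation hM := (gm_grading M).

Lemma comp_scale (m : nat) (n : int) (r : R) (v : M) :
  r \in Rn m -> comp hM (m%:Z + n) (r *: v) = r *: comp hM n v.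
Proof.
move=> rm; apply: (comp_map hM hM (f := fun v => r *: v) (phi := fun n => m%:Z + n)).
- by move=> u w; rewrite scalerDr.
- exact: addrI.
- by move=> k w; apply: gm_scale.
Qed.

Lemma deg_submod n : @is_submod R0 (restr_scalars M) (fun v => v \in gm_deg M n).
Proof.
split; first exact: (grading0 hM n).
move=> a u v un vn; apply: (gradingD hM) => //.
by have := gm_scale (alg_deg0 a) un; rewrite add0r.
Qed.

(** Closed under scalars because R lives in degrees >= 0. *)
Lemma below_submod (N : int) :
  is_submod (fun v : M => forall n, n <= N -> comp hM n v = 0).
Proof.
split=> [n _|r u v hu hv n nN]; first exact: comp0.
rewrite compD hv // addr0; have [s [_ -> _]] := comp_sum hg r.
rewrite scaler_suml comp_bigsum big1 // => m _.
have -> : n = m%:Z + (n - m%:Z) by lia.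
by rewrite comp_scale ?comp_mem // hu ?scaler0 //; lia.
Qed.

Lemma below_ex (v : M) : exists N : int, forall n, n <= N -> comp hM n v = 0.
Proof.
have [s [_ _ s0]] := comp_sum hM v.
have [N hN] : exists N : int, forall n, n \in s -> N < n.
  elim: s {s0} => [|n s [N hN]]; first by exists 0.
  exists (Num.min N (n - 1)) => m; rewrite inE => /orP[/eqP ->|/hN]; lia.
exists N => n nN; apply: s0; apply/negP => /hN; lia.
Qed.

Lemma below_span (s : seq M) : exists N : int,
  forall v, lspan s v -> forall n, n <= N -> comp hM n v = 0.
Proof.
have [N hN] : exists N : int, forall v, v \in s -> forall n, n <= N -> comp hM n v = 0.
  elim: s => [|v s [N hN]]; first by exists 0.
  have [N' hN'] := below_ex v; exists (Num.min N N') => w.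
  rewrite inE => /orP[/eqP -> n nN|/hN h n nN]; [apply: hN'|apply: h]; lia.
by exists N => v; apply: (lspan_min (below_submod N) hN).
Qed.

Lemma noeth_deg n : @fin_gen R M predT ->
  @noeth R0 (restr_scalars M) (fun v => v \in gm_deg M n) (eq^~ 0).
Proof.
move=> /fin_gen_span[s [_ sgen]].
apply: (@noeth_piece int M (gm_deg M) hM (fun m => m%:Z + n) n).
- by move=> a b /addIr [].
- by rewrite add0r.
- by move=> m r v; apply: gm_scale.
apply: (noeth_inj (Z' := lspan s) (B' := eq^~ 0) (g := id)) => //.
- exact: is_submod1.
- by move=> v _; apply: sgen.
- exact: noeth_span.
Qed.

Lemma deg_below : @fin_gen R M predT ->
  exists N, forall n, n <= N -> forall v, v \in gm_deg M n -> v = 0.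
Proof.
move=> /fin_gen_span[s [_ sgen]]; have [N hN] := below_span s.
by exists N => n nN v vn; rewrite -(comp_id hM vn) hN //; apply: sgen.
Qed.

End GradedModule.
End StandardGraded.

(** * Torsion *)

Section Nakayama.
Variables (A : comNzRingType) (m0 : idealr A).
Hypotheses (hlocal : local_ring m0) (hA : @noeth A A^o (fun=> True) (eq^~ 0)).

(** Otherwise an ideal maximal among those containing 1 - a but not 1 is a maximal ideal, hence m0,
    and contains both a and 1 - a. *)
Lemma local_unit a : a \in m0 -> exists c, (1 - a) * c = 1.
Proof.
move=> am; apply: contrapT => nounit.
pose P (S : A^o -> Prop) := [/\ is_submod S, S (1 - a) & ~ S 1].
pose S0 (r : A^o) := exists c : A, r = (1 - a) * c.
have [|||S [[hS Sa S1] Smax]] := noeth_max (P := P) (S0 := S0) _ hA.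
- exact: is_submod1.
- split.
  + split; first by exists 0; rewrite mulr0.
    move=> c _ _ [u ->] [v ->]; exists (c * u + v).
    by rewrite mulrDr; congr (_ + _); rewrite -[LHS]/(c * _) mulrCA.
  + by exists 1; rewrite mulr1.
  + by move=> [c ec]; apply: nounit; exists c.
- by move=> S [hS _ _]; split=> // v ->; apply: submod0.
pose m : {pred A} := fun r => `[< S r >].
have mE r : r \in m <-> S r by rewrite unfold_in /m; split=> /asboolP.
have im : idealr_closed m.
  split; first by apply/mE; exact: (submod0 hS).
    by apply/negP => /mE.
  by move=> c u v /mE Su /mE Sv; apply/mE; apply: (proj2 hS).
have mm : maximal_ideal m.
  split=> // I [I0 I1 ID] mI r; apply/idP/idP; last exact: mI.
  move=> rI; apply/mE; apply: (Smax (fun r : A^o => r \in I)) => //.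
    split=> //; last exact/negP.
      by apply: mI; apply/mE.
  by move=> v /mE; apply: mI.
have /mE Sa' : a \in m by rewrite (proj2 hlocal m mm).
by apply: S1; rewrite -(subrK a 1); apply: (submodD hS).
Qed.

Variables (J : {pred A}) (V : lmodType A).
Hypotheses (hJ : @is_submod A A^o (fun a => a \in J)) (Jm : {subset J <= m0}).

(** The product of J with the span of [g]. *)
Definition jspan (g : seq V) (w : V) : Prop :=
  forall S, is_submod S -> (forall a y, a \in J -> y \in g -> S (a *: y)) -> S w.

Lemma jspan_submod g : is_submod (jspan g).
Proof.
split=> [S hS _|a u v hu hv S hS gS]; first exact: submod0.
by apply: (proj2 hS); [apply: hu | apply: hv].
Qed.

Lemma jspan_cons x g w :
  jspan (x :: g) w -> exists a u, [/\ a \in J, jspan g u & w = a *: x + u].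
Proof.
move=> hw; pattern w; apply: hw; first split.
- exists 0, 0; rewrite scale0r addr0; split=> //; first exact: (submod0 hJ).
  exact: (submod0 (jspan_submod g)).
- move=> a _ _ [b [u [bJ hu ->]]] [c [v [cJ hv ->]]].
  exists (a * b + c), (a *: u + v); split.
  + exact: (proj2 hJ).
  + exact: (proj2 (jspan_submod g)).
  + by rewrite scalerDr scalerDl scalerA addrACA.
move=> a y aJ; rewrite inE => /orP[/eqP ->|yg].
  by exists a, 0; rewrite addr0; split=> //; exact: (submod0 (jspan_submod g)).
exists 0, (a *: y); rewrite scale0r add0r; split=> //; first exact: (submod0 hJ).
by move=> S _; apply.
Qed.

(** Elimination of one generator at a time: modulo N, x = a x + u with a in J gives x = c u, where c
    inverts 1 - a. Substituting this into the other relations keeps their coefficients in J. *)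
Lemma nakayama (N : V -> Prop) (g : seq V) :
  is_submod N -> (forall y, y \in g -> exists2 w, jspan g w & N (y - w)) ->
  forall y, y \in g -> N y.
Proof.
move=> hN; elim: g => [//|x g IH] hg.
have [w /jspan_cons[a [u [aJ hu ->]]] Nx] := hg x (mem_head _ _).
have [c ec] := local_unit (Jm aJ).
have Nxu : N (x - c *: u).
  have -> : x - c *: u = c *: (x - (a *: x + u)).
    rewrite opprD addrA scalerBr; congr (_ - _).
    by rewrite -[X in X - _]scale1r -scalerBl scalerA mulrC ec scale1r.
  exact: submodZ.
have Ng y : y \in g -> N y.
  apply: IH => {}y yg; have [|_ /jspan_cons[b [v [bJ hv ->]]] Ny] := hg y.
    by rewrite inE yg orbT.
  exists ((b * c) *: u + v); first exact: (proj2 (jspan_submod g)).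
  have -> : y - ((b * c) *: u + v) = (y - (b *: x + v)) + b *: (x - c *: u).
    by rewrite scalerBr scalerA !opprD addrACA [X in _ + X]addrC !addrA addrK addrAC.
  by apply: (submodD hN) => //; apply: submodZ.
move=> y; rewrite inE => /orP[/eqP ->|/Ng//].
apply: (submod_subr hN Nxu); apply: submodZ => //.
by apply: hu => // b z _ zg; apply: submodZ => //; apply: Ng.
Qed.

End Nakayama.

Definition powtors (R : comNzRingType) (V : lmodType R) (s : seq R) (v : V) : Prop :=
  exists m : nat, forall x, x \in s -> x ^+ m *: v = 0.

Section PowerTorsion.
Variables (R : comNzRingType) (V : lmodType R).

Lemma exp_kill (x : R) (v : V) m n : (m <= n)%N -> x ^+ m *: v = 0 -> x ^+ n *: v = 0.
Proof. by move=> /subnK <- e; rewrite exprD -scalerA e scaler0. Qed.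

Lemma powtors_submod (s : seq R) : is_submod (@powtors R V s).
Proof.
split=> [|a u v [m hu] [n hv]]; first by exists 0%N => x _; rewrite scaler0.
exists (maxn m n) => x xs; rewrite scalerDr scalerA mulrC -scalerA.
rewrite (exp_kill (leq_maxl m n) (hu x xs)) scaler0 add0r.
exact: (exp_kill (leq_maxr m n) (hv x xs)).
Qed.

Lemma powtors_intro (s : seq R) (v : V) :
  (forall x, x \in s -> exists m : nat, x ^+ m *: v = 0) -> powtors s v.
Proof. by apply: list_bound => x m n; apply: exp_kill. Qed.

Lemma powtors_cons x (s : seq R) (v : V) :
  powtors (x :: s) v <-> (exists m : nat, x ^+ m *: v = 0) /\ powtors s v.
Proof.
split=> [[m hm]|[xv [m hm]]].
  by split; [exists m | exists m => y ys]; apply: hm; rewrite inE ?eqxx ?ys ?orbT.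
by apply: powtors_intro => y; rewrite inE => /orP[/eqP ->//|/hm]; exists m.
Qed.

Lemma powtors_exp (s : seq R) n (v : V) :
  (forall x, x \in s -> powtors s (x ^+ n *: v)) -> powtors s v.
Proof.
move=> h; apply: powtors_intro => x xs; have [m hm] := h x xs.
by exists (m + n)%N; rewrite exprD -scalerA; apply: hm.
Qed.

(* By induction on the total exponent [\sum_(x <- s) m x], where [m x] is such
   that [x ^+ m x] kills the element. *)
Lemma powtors_prod (s : seq R) (I : {pred R}) (v : V) :
  {subset I <= ideal_gen (mem s)} -> powtors s v ->
  exists N : nat, forall t : seq R, (N <= size t)%N -> {subset t <= I} ->
    (\prod_(y <- t) y) *: v = 0.
Proof.
move=> Is [m0 hm0].
suff main k : forall (m : R -> nat) (w : V), (\sum_(x <- s) m x <= k)%N ->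
    (forall x, x \in s -> x ^+ m x *: w = 0) ->
  exists N : nat, forall t : seq R, (N <= size t)%N -> {subset t <= I} ->
    (\prod_(y <- t) y) *: w = 0 by exact: (main _ (fun=> m0) v (leqnn _) hm0).
elim: k => [|k IH] m w mk hm.
  have [N hN] : exists N : nat, forall x, x \in s -> w = 0.
    exists 0%N => x xs; rewrite -(hm x xs) (_ : m x = 0%N) ?scale1r //.
    by move: mk; rewrite (big_rem x xs) /=; lia.
  exists 1%N => -[//|y t] _ tI; rewrite big_cons.
  case: s hN Is {hm0 hm mk} => [|x s] hN Is; last first.
    by rewrite (hN x) ?mem_head ?scaler0.
  have /asboolP[L [hL ->]] := Is y (tI y (mem_head _ _)).
  rewrite big1_seq ?mul0r ?scale0r // => p /andP[_ /hL]; by rewrite inE.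
have [N hN] : exists N : nat, forall x, x \in s -> forall t : seq R,
    (N <= size t)%N -> {subset t <= I} -> (\prod_(y <- t) y) *: (x *: w) = 0.
  apply: list_bound => [x a b ab h t bt|x xs].
    by apply: h; apply: leq_trans bt.
  have [mx0|mx0] := posnP (m x).
    exists 0%N => t _ _; rewrite (_ : w = 0) ?scaler0 //.
    by rewrite -(hm x xs) mx0 scale1r.
  apply: (IH (fun y => if y == x then (m x).-1 else m y)).
    have : (\sum_(y <- s) (if y == x then (m x).-1 else m y) < \sum_(y <- s) m y)%N.
      rewrite (big_rem x xs) [ltnRHS](big_rem x xs) /= eqxx -addSn prednK //.
      by rewrite leq_add2l; apply: leq_sum => y _; case: eqP => // ->; apply: leq_pred.
    by move/leq_trans => /(_ _ mk).
  move=> y ys; case: eqP => [->|_]; last by rewrite scalerA mulrC -scalerA hm ?scaler0.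
  by rewrite scalerA -exprSr prednK // hm.
exists N.+1 => -[//|y t] Nt tI; rewrite big_cons.
have /asboolP[L [hL ->]] := Is y (tI y (mem_head _ _)).
rewrite mulr_suml scaler_suml big1_seq // => p /andP[_ /hL ps].
rewrite mulrAC -!scalerA hN ?scaler0 //.
by move=> z zt; apply: tI; rewrite inE zt orbT.
Qed.

End PowerTorsion.

Section GradedTorsion.
Variables (R0 : comNzRingType) (R : comAlgType R0) (Rn : nat -> {pred R}).
Hypothesis hR : standard_graded Rn.
Hypothesis noethR : @noeth R R^o (fun=> True) (eq^~ 0).
Variable s : seq R.
Hypotheses (s1 : {subset s <= Rn 1%N})
  (sgen : forall S : {pred R}, subalg_closed S -> {subset s <= S} -> S =i predT).

Local Notation hg := (sg_grading hR).

Let mon (L : seq (R0 * seq R)) : R := \sum_(p <- L) p.1 *: \prod_(y <- p.2) y.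

(** The R_0-combinations of monomials in s form a subalgebra containing s. *)
Lemma monomials r : exists L : seq (R0 * seq R),
  (forall p, p \in L -> {subset p.2 <= s}) /\ r = \sum_(p <- L) p.1 *: \prod_(y <- p.2) y.
Proof.
pose S : {pred R} := fun r => `[< exists L : seq (R0 * seq R),
  (forall p, p \in L -> {subset p.2 <= s}) /\ r = mon L >].
have SE u : u \in S <-> exists L : seq (R0 * seq R),
    (forall p, p \in L -> {subset p.2 <= s}) /\ u = mon L.
  by rewrite unfold_in /S; split=> /asboolP.
apply/SE; rewrite (sgen (S := S)) //; last first.
  move=> x xs; apply/SE; exists [:: (1, [:: x])]; split.
    by move=> p; rewrite inE => /eqP -> y; rewrite inE => /eqP ->.
  by rewrite /mon !big_seq1 scale1r.
split.
- apply/SE; exists [:: (1, [::])]; split; first by move=> p; rewrite inE => /eqP ->.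
  by rewrite /mon big_seq1 big_nil scale1r.
- move=> a _ _ /SE[L [hL ->]] /SE[L' [hL' ->]]; apply/SE.
  exists ([seq (a * p.1, p.2) | p <- L] ++ L'); split.
    by move=> p; rewrite mem_cat => /orP[/mapP[q qL ->]|/hL']; [apply: (hL q)|].
  rewrite /mon big_cat big_map scaler_sumr; congr (_ + _).
  by apply: eq_bigr => p _; rewrite scalerA.
move=> _ _ /SE[L [hL ->]] /SE[L' [hL' ->]]; apply/SE.
exists [seq (p.1 * q.1, p.2 ++ q.2) | p <- L, q <- L']; split.
  move=> _ /allpairsP[[p q] [pL qL ->]] y; rewrite mem_cat => /orP[]; [exact: (hL p)|exact: (hL' q)].
rewrite /mon big_allpairs_dep mulr_suml; apply: eq_bigr => p _.
rewrite mulr_sumr; apply: eq_bigr => q _ /=.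
by rewrite big_cat /= -scalerAl -scalerAr scalerA.
Qed.

Lemma prod_deg (t : seq R) : {subset t <= Rn 1%N} -> \prod_(y <- t) y \in Rn (size t).
Proof.
elim: t => [|y t IH] h; first by rewrite big_nil -[1]scale1r; apply: (alg_deg0 hR).
rewrite big_cons /= -add1n; apply: (sg_mul hR); first by apply: h; rewrite mem_head.
by apply: IH => z zt; apply: h; rewrite inE zt orbT.
Qed.

Lemma scale_deg (a : R0) n r : r \in Rn n -> a *: r \in Rn n.
Proof.
by move=> /(sg_mul hR (alg_deg0 hR a)); rewrite -scalerAl mul1r.
Qed.

Lemma Rn_submod n : @is_submod R0 (restr_scalars R^o) (fun v => v \in Rn n).
Proof.
split=> [|a u v un vn]; first exact: (grading0 hg).
apply: (gradingD hg) vn.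
by rewrite -[X in X \in _]/(a%:A * (u : R)) mulr_algl; apply: scale_deg.
Qed.

Lemma homog_monomials n r : r \in Rn n -> exists L : seq (R0 * seq R),
  (forall p, p \in L -> {subset p.2 <= s} /\ size p.2 = n) /\
  r = \sum_(p <- L) p.1 *: \prod_(y <- p.2) y.
Proof.
move=> rn; have [L [hL er]] := monomials r.
exists [seq p <- L | size p.2 == n]; split.
  by move=> p; rewrite mem_filter => /andP[/eqP ? /hL].
rewrite -(comp_id hg rn) er comp_bigsum big_filter [RHS]big_mkcond /=.
rewrite !big_seq; apply: eq_bigr => p /hL ps.
have pd : p.1 *: \prod_(y <- p.2) y \in Rn (size p.2).
  by apply/scale_deg/prod_deg => y /ps/s1.
by case: eqP => [<-|/eqP ne]; [apply: comp_id | apply: (comp_ne _ pd); rewrite eq_sym].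
Qed.

Lemma Rn1_irrelevant : {subset Rn 1%N <= irrelevant Rn}.
Proof.
move=> x x1; apply/asboolP; exists 2%N, (fun n => if n == 1%N then x else 0).
split; last by rewrite big_nat1.
by move=> n; case: eqP => [->|_] //; apply: (grading0 hg).
Qed.

Lemma irrelevant_gen : {subset irrelevant Rn <= ideal_gen (mem s)}.
Proof.
move=> r /asboolP[N [f [fn ->]]]; rewrite big_seq_cond.
apply: (big_ind (fun x => x \in ideal_gen (mem s))); first exact: rpred0.
  by move=> u v us vs; apply: rpredD.
move=> n /andP[]; rewrite mem_index_iota => /andP[n1 _] _.
have [L [hL ->]] := homog_monomials (fn n); rewrite big_seq.
apply: (big_ind (fun x => x \in ideal_gen (mem s))); first exact: rpred0.
  by move=> u v us vs; apply: rpredD.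
move=> [a [|y t]] /hL[/= ts st]; first by move: n1; rewrite -st.
apply/asboolP; exists [:: (a *: \prod_(z <- t) z, y)]; split.
  by move=> p; rewrite inE => /eqP -> /=; apply: ts; rewrite mem_head.
by rewrite big_seq1 big_cons /= -scalerAl mulrC.
Qed.

Lemma Rn_ideal_pow n : {subset Rn n <= ideal_pow (irrelevant Rn) n}.
Proof.
move=> r /homog_monomials[L [hL ->]]; rewrite big_seq.
apply: (big_ind (fun x => x \in ideal_pow (irrelevant Rn) n)); first exact: rpred0.
  by move=> u v us vs; apply: rpredD.
move=> [a t] /hL[/= ts st]; apply/asboolP; exists [:: (a%:A, \prod_(y <- t) y)].
split; last by rewrite big_seq1 /= -scalerAl mul1r.
move=> p; rewrite inE => /eqP -> /=; apply/asboolP; exists t; split=> //.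
by move=> y /ts/s1/Rn1_irrelevant.
Qed.

(** A power of R_+ kills v, so b = 0 can be taken in the definition of torsion. *)
Lemma powtors_torsion (V : lmodType R) (J : submodClosed R^o) (v : V) :
  powtors s v -> v \in torsion (irrelevant Rn) J V.
Proof.
move=> /(powtors_prod irrelevant_gen)[N hN]; apply/asboolP; exists N => n Nn a.
move=> /asboolP[L [hL ->]]; exists 0; first exact: rpred0.
rewrite scale0r scaler_suml big1_seq // => p /andP[_ /hL/asboolP[t [st tI ->]]].
by rewrite -scalerA hN ?scaler0 ?st.
Qed.

Variable M : grmod Rn.
Local Notation hM := (gm_grading M).

Lemma exp_deg x n : x \in Rn 1%N -> x ^+ n \in Rn n.
Proof.
move=> x1; have := @prod_deg (nseq n x); rewrite size_nseq big_nseq.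
have -> : iter n ( *%R x) 1 = x ^+ n by elim: n => //= n ->; rewrite exprS.
by apply=> y /nseqP[-> _].
Qed.

Lemma powtors_comp (n : int) (v : M) : powtors s v -> powtors s (comp hM n v).
Proof.
move=> [m hm]; exists m => x xs.
by rewrite -(comp_scale n v (exp_deg m (s1 xs))) hm // comp0.
Qed.

Variables (m0 J0 : idealr R0).
Hypotheses (hlocal : local_ring m0) (J0m : {subset J0 <= m0}).

Let ptM : is_submod (@powtors R M s) := @powtors_submod R M s.

(** Torsion tested on one power of R_+ only; this form passes from x to r x at once. *)
Let G (x : M) := exists n : nat, forall a, a \in ideal_pow (irrelevant Rn) n ->
  exists2 b, b \in extend_ideal R J0 & a *: x = b *: x.

(* If every homogeneous [r] that moves one non-torsion component of [x] into
   the torsion moves all of [x] there, then the annihilator of [x] modulo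
   torsion is homogeneous and Nakayama's lemma applies in a single degree. *)
Let torsion_step (x : M) : G x ->
  (forall m (r : R) k, r \in Rn m -> ~ powtors s (comp hM k x) ->
     powtors s (r *: comp hM k x) -> powtors s (r *: x)) ->
  powtors s x.
Proof.
move=> [n Gn] hx; apply: contrapT => nx.

(* The lowest degree carrying a non-torsion component. *)
have [k0 [nk0 lowk0]] : exists k0, ~ powtors s (comp hM k0 x) /\
    forall k, k < k0 -> powtors s (comp hM k x).
  have [k1 nk1] : exists k, ~ powtors s (comp hM k x).
    apply: contrapT => allk; apply: nx; have [S [_ -> _]] := comp_sum hM x.
    apply: (big_ind (powtors s)); first exact: (submod0 ptM).
      by move=> *; apply: (submodD ptM).
    by move=> k _; apply: contrapT => nk; apply: allk; exists k.
  have [N hN] := below_ex x.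
  have Nk1 : N < k1.
    rewrite ltNge; apply/negP => k1N; apply: nk1; rewrite hN //; exact: (submod0 ptM).
  pose P m := `[< ~ powtors s (comp hM (N + m%:Z) x) >].
  have exP : exists m, P m.
    exists `|k1 - N|%N; apply/asboolP; rewrite (_ : N + _ = k1) //; lia.
  have [m /asboolP Pm mmin] := ex_minnP exP.
  exists (N + m%:Z); split=> // k km; apply: contrapT => nk.
  have [kN|Nk] := leP k N; first by apply: nk; rewrite hN //; exact: (submod0 ptM).
  have /mmin : P `|k - N|%N.
    apply/asboolP; rewrite (_ : N + _ = k) //; lia.
  by lia.
(* In degree j + k0 of r x, the terms from r_i with i < j are torsion by induction, and those with i
   > j involve components of x below k0. So r_j x_(k0) is torsion, and [hx] extends this to r_j
   x. *)
have homog_ann (r : R) : powtors s (r *: x) -> forall j, powtors s (comp hg j r *: x).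
  move=> rx; elim/ltn_ind => j IH.
  apply: (@hx j _ k0 (comp_mem hg j r) nk0).
  have [S [uS er S0]] := comp_sum hg r.
  have [jS|/S0 ->] := boolP (j \in S); last by rewrite scale0r; exact: (submod0 ptM).
  have := powtors_comp (j%:Z + k0) rx.
  rewrite {1}er scaler_suml comp_bigsum (bigD1_seq j) //= comp_scale ?comp_mem //.
  move=> h; apply: (submod_subr (v := - \sum_(i <- S | i != j)
    comp hM (j%:Z + k0) (comp hg i r *: x)) ptM); first by rewrite opprK.
  apply: (submodN ptM); apply: (big_ind (powtors s)); first exact: (submod0 ptM).
    by move=> *; apply: (submodD ptM).
  move=> i ij; have [lt_ij|le_ji] := ltnP i j.
    by apply: powtors_comp; apply: IH.
  rewrite (_ : j%:Z + k0 = i%:Z + (j%:Z + k0 - i%:Z)); last by lia.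
  rewrite comp_scale ?comp_mem //; apply: (submodZ ptM); apply: lowk0.
  by move: ij; rewrite neq_ltn ltnNge le_ji /=; lia.
have [g [gn ggen]] := @noeth_Rn _ _ _ hR noethR n _ (Rn_submod n) (fun v => id).
have J0sub : @is_submod R0 R0^o (fun a => a \in J0).
  by split=> [|a u v uJ vJ]; [apply: rpred0 | apply: rpredD => //; apply: idealMr].
pose N (r : restr_scalars R^o) := powtors s ((r : R) *: x).
have hN : is_submod N.
  split; first by rewrite /N scale0r; apply: (submod0 ptM).
  move=> a u v Nu Nv; rewrite /N [(_ *: u + v : R)]/(a%:A * u + v : R).
  by rewrite scalerDl -scalerA; apply: (proj2 ptM).
(* Nakayama over R_0 on the generators [g] of R_n: y x = b x with b in J_0 R, and [homog_ann] allows
   b to be replaced by its degree n component, which lies in J_0 R_n. *)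
have Ng : forall y, y \in g -> N y.
  apply: (nakayama hlocal (noethR0 hR noethR) J0sub J0m hN) => y yg.
  have yn := gn y yg.
  have [b bJ eb] := Gn y (Rn_ideal_pow yn).
  exists (comp hg n b); last first.
    have : powtors s ((y - b) *: x) by rewrite scalerBl eb subrr; apply: (submod0 ptM).
    by move/homog_ann => /(_ n); rewrite compB (comp_id hg yn).
  move: bJ => /asboolP[L [hL ->]]; rewrite comp_bigsum big_seq.
  have js := jspan_submod (V := restr_scalars R^o) J0 g.
  apply: (big_ind (@jspan R0 J0 (restr_scalars R^o) g)); first exact: (submod0 js).
    by move=> *; apply: (submodD js).
  move=> p /hL/asboolP[a aJ ->].
  have -> : comp hg n (p.1 * a%:A) = a%:A * comp hg n p.1.
    have -> : p.1 * a%:A = a%:A * p.1 by rewrite mulrC.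
    apply: (comp_map hg hg (f := fun r => a%:A * r) (phi := id)) => //.
      by move=> u v; rewrite mulrDr.
    by move=> k v vk; rewrite -scalerAl mul1r; apply: scale_deg.
  have [w [gw /eqP]] := ggen _ (comp_mem hg n p.1).
  rewrite subr_eq0 => /eqP ->; move: gw.
  move=> gw S hS gS; pattern w; apply: gw; last by move=> z zg; apply: gS.
  split.
    by rewrite -[X in S X]/(a *: (0 : restr_scalars R^o)) scaler0; apply: (submod0 hS).
  move=> c u v Su Sv.
  rewrite -[X in S X]/(a *: (c *: u + v : restr_scalars R^o)) scalerDr scalerA mulrC.
  by rewrite -scalerA; apply: (proj2 hS).
have NRn r : r \in Rn n -> N r.
  move=> /ggen[w [gw /eqP]]; rewrite subr_eq0 => /eqP ->.
  exact: lspan_min hN Ng gw.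
apply: nx; apply: (powtors_exp (n := n)) => y ys; apply: NRn.
exact/exp_deg/s1.
Qed.

(** Induction on a bound [c] for the number of degrees with non-torsion component. If a homogeneous
    r makes one such component torsion, r x has fewer of them, so the induction hypothesis supplies
    exactly what [torsion_step] asks for. *)
Lemma torsion_powtors (x : M) :
  x \in torsion (irrelevant Rn) (extend_ideal R J0) M -> powtors s x.
Proof.
move=> /asboolP[n0 hn0]; have {n0 hn0} : G x by exists n0; apply: hn0.
have [S [_ _ S0]] := comp_sum hM x.
have {S0} : forall k, k \notin S -> powtors s (comp hM k x).
  by move=> k /S0 ->; apply: (submod0 ptM).
move: {2}(size S) (leqnn (size S)) => c.
elim: c x S => [|c IH] x S Sc Sx Gx; apply: torsion_step => // m r k rm nk rk.
  by case: nk; apply: Sx; move: Sc; rewrite leqn0 => /nilP ->.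
have kS : k \in S by apply: contrapT => /negP /Sx.
apply: (IH _ [seq m%:Z + j | j <- rem k S]).
- by rewrite size_map size_rem //; move: Sc; case: (size S).
- move=> j; rewrite (_ : j = m%:Z + (j - m%:Z)); last by lia.
  rewrite mem_map; last by move=> a b /addrI.
  move=> jS; rewrite comp_scale //.
  have [->//|jk] := eqVneq (j - m%:Z) k.
  apply: (submodZ ptM); apply: Sx; apply: contra jS => jS.
  by have := perm_to_rem kS => /perm_mem/(_ (j - m%:Z)); rewrite jS inE (negPf jk).
move: Gx => [n Gn]; exists n => a /Gn[b bJ eb]; exists b => //.
by rewrite scalerA mulrC -scalerA eb scalerA mulrC scalerA.
Qed.

End GradedTorsion.

(** * Extending homomorphisms from graded ideals *)

Section Submodule.
Variables (A : comNzRingType) (V : lmodType A) (P : {pred V}).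
Hypothesis hP : submod_closed P.

(** The dummy argument carries the closure proof, so that the instance below can be inferred. *)
Definition sub_pred of submod_closed P : {pred V} := P.

HB.instance Definition _ :=
  GRing.isSubmodClosed.Build A V (sub_pred hP) hP.

Definition subm := {x : V | x \in sub_pred hP}.

HB.instance Definition _ := SubChoice.on subm.
HB.instance Definition _ := [SubChoice_isSubLmodule of subm by <:].

End Submodule.

Section GradedInjective.
Variables (R0 : comNzRingType) (R : comAlgType R0) (Rn : nat -> {pred R}).
Hypothesis hR : standard_graded Rn.
Hypothesis noethR : @noeth R R^o (fun=> True) (eq^~ 0).

Local Notation hg := (sg_grading hR).

Section ShiftedRing.
Variable c : int.

(** The grading of R(-c), in which the unit has degree c. The disjunct r = 0 covers the degrees
    below c. *)
Definition shift_deg (n : int) : {pred R^o} :=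
  fun r => `[< r = 0 \/ exists2 m : nat, n = m%:Z + c & r \in Rn m >].

Lemma shift_degP n r :
  r \in shift_deg n <-> r = 0 \/ exists2 m : nat, n = m%:Z + c & r \in Rn m.
Proof. by rewrite unfold_in /shift_deg; split=> /asboolP. Qed.

Lemma shift_grading : grading shift_deg.
Proof.
split.
- move=> n; split; first by apply/shift_degP; left.
  move=> u v /shift_degP[->|[m em um]] /shift_degP[->|[k ek vk]].
  + by apply/shift_degP; left; rewrite subr0.
  + by apply/shift_degP; right; exists k => //; rewrite sub0r; apply: (gradingN hg).
  + by apply/shift_degP; right; exists m => //; rewrite subr0.
  + apply/shift_degP; right; exists m => //; apply: (gradingB hg) => //.
    by move: ek; rewrite em => /addIr[->].
- move=> r; have [s [us er _]] := comp_sum hg r.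
  exists [seq m%:Z + c | m : nat <- s].
  exists (fun n => if 0 <= n - c then comp hg `|n - c|%N r else 0); split.
    move=> n; apply/shift_degP; case: ifP => nc; [right|by left].
    by exists `|n - c|%N; [lia|apply: comp_mem].
  by rewrite big_map [LHS]er; apply: eq_bigr => m _; rewrite addrK.
move=> s f us fs sum0 n ns.
have /shift_degP[//|[m em fm]] := fs n; rewrite em in ns *.
have : comp hg m (\sum_(k <- s) f k) = 0 by rewrite sum0 comp0.
rewrite comp_bigsum (bigD1_seq (m%:Z + c)) //= -em (comp_id hg fm) big1 ?addr0 //.
move=> k km; have /shift_degP[->|[j ej fj]] := fs k; first exact: comp0.
by apply: (comp_ne hg fj); apply: contraNneq km => mj; rewrite ej em mj.
Qed.

Lemma shift_scale (m : nat) (n : int) (r : R) (x : R^o) :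
  r \in Rn m -> x \in shift_deg n -> r *: x \in shift_deg (m%:Z + n).
Proof.
move=> rm /shift_degP[->|[k -> xk]]; apply/shift_degP; first by left; rewrite scaler0.
by right; exists (m + k)%N; [rewrite PoszD addrA|apply: (sg_mul hR)].
Qed.

Definition shifted_ring : grmod Rn := GrMod shift_grading shift_scale.

Variables (I : {pred R^o}) (hI : submod_closed I).
Hypothesis Icomp : forall j r, r \in I -> comp hg j r \in I.

Definition ideal_deg (n : int) : {pred subm hI} := [pred u | \val u \in shift_deg n].

Lemma ideal_grading : grading ideal_deg.
Proof.
have [sz sd su] := shift_grading.
split.
- move=> n; split; first by apply/shift_degP; left; rewrite raddf0.
  move=> u v un vn; rewrite -[_ \in _]/(\val (u - v) \in shift_deg n) raddfB.
  by case: (sz n) => _; apply.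
- move=> [r rI]; have [s [us er _]] := comp_sum hg r.
  pose g (m : nat) : subm hI := exist _ (comp hg m r) (Icomp m rI).
  exists [seq m%:Z + c | m : nat <- s].
  exists (fun n => if 0 <= n - c then g `|n - c|%N else 0); split.
    move=> n; apply/shift_degP; case: ifP => nc; last by left; rewrite raddf0.
    by right; exists `|n - c|%N; [lia|apply: comp_mem].
  apply: val_inj; rewrite big_map raddf_sum /= [LHS]er; apply: eq_bigr => m _.
  by rewrite addrK.
move=> s f us fs sum0 n ns; apply: val_inj; rewrite raddf0.
apply: (su s (fun n => \val (f n)) us) => //.
by have := congr1 val sum0; rewrite raddf_sum raddf0.
Qed.

Lemma ideal_scale (m : nat) (n : int) (r : R) (x : subm hI) :
  r \in Rn m -> x \in ideal_deg n -> r *: x \in ideal_deg (m%:Z + n).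
Proof. move=> rm xn; rewrite -[_ \in _]/(\val (r *: x) \in shift_deg (m%:Z + n)) linearZ.
exact: shift_scale. Qed.

Definition graded_ideal : grmod Rn := GrMod ideal_grading ideal_scale.

(** Graded Baer criterion: on a homogeneous ideal, a homomorphism of degree c is a degree 0 map from
    a graded submodule of R(-c); e is the image of 1 under an extension. The function [h] is total
    but constrained on I only. *)
Lemma gr_injective_extend (E : grmod Rn) (h : R -> E) :
  gr_injective E ->
  (forall a u v, u \in I -> v \in I -> h (a * u + v) = a *: h u + h v) ->
  (forall m r, r \in I -> r \in Rn m -> h r \in gm_deg E (m%:Z + c)) ->
  exists2 e, e \in gm_deg E c & forall r, r \in I -> h r = r *: e.
Proof.
move=> hE hlin hdeg.
have glin : linear (fun u : graded_ideal => h (\val (u : subm hI))).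
  move=> a u v; rewrite -hlin; [|exact: (valP (u : subm hI))|exact: (valP (v : subm hI))].
  by congr h; rewrite linearP.
pose g : {linear graded_ideal -> E} := HB.pack (fun u : graded_ideal => h (\val (u : subm hI)))
  (GRing.isLinear.Build R graded_ideal E *:%R _ glin).
have flin : linear ((fun u => \val (u : subm hI)) : graded_ideal -> shifted_ring).
  by move=> a u v; rewrite linearP.
pose f : {linear graded_ideal -> shifted_ring} :=
  HB.pack ((fun u => \val (u : subm hI)) : graded_ideal -> shifted_ring)
  (GRing.isLinear.Build R graded_ideal shifted_ring *:%R _ flin).
have [|||H Hdeg Hg] := hE graded_ideal shifted_ring f g.
- by [].
- move=> n u /shift_degP[u0|[m -> um]]; rewrite /g /=; last by apply: hdeg => //; apply: (valP u).
  have -> : h (\val u) = 0.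
    have I0 : 0 \in I by case: hI.
    rewrite u0; have := hlin (-1) 0 0 I0 I0.
    by rewrite mulr0 addr0 scaleN1r addNr.
  exact: (grading0 (gm_grading E)).
- exact: val_inj.
exists (H (1 : R^o)).
  apply: Hdeg; apply/shift_degP; right; exists 0%N; first by rewrite add0r.
  by have := alg_deg0 hR 1; rewrite scale1r.
move=> r rI; have := Hg (exist _ r rI : subm hI); rewrite /f /g /= => <-.
by rewrite -linearZ; congr (H _); rewrite -[RHS]/(r * 1) mulr1.
Qed.

End ShiftedRing.

Lemma compMr (m j : nat) (c y : R) : y \in Rn m ->
  comp hg j (c * y) = if (m <= j)%N then comp hg (j - m)%N c * y else 0.
Proof.
move=> ym; case: leqP => mj.
  rewrite -{1}(subnK mj).
  apply: (comp_map hg hg (f := fun c => c * y) (phi := fun i => (i + m)%N)).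
  - by move=> u v; rewrite mulrDl.
  - exact: addIn.
  - by move=> n v vn; apply: (sg_mul hR).
have [s [_ -> _]] := comp_sum hg c; rewrite mulr_suml comp_bigsum big1 // => i _.
apply: (comp_ne hg (n := (i + m)%N)); first by apply: (sg_mul hR) => //; apply: comp_mem.
by lia.
Qed.

(* Multiplication by [x] is onto modulo [x]-torsion: with [a] generated by
   powers of [t] and [a : x^k = a : x^(k+1)], the map sending [x^(k+1)] to
   [x^k e] and [a] to [0] is well defined on the ideal [a + (x^(k+1))]; it
   extends to [R] by injectivity. *)
Lemma gr_injective_divide (E : grmod Rn) (t : seq R) (x : R) (n : int) (e : E) :
  gr_injective E -> {subset t <= Rn 1%N} -> x \in Rn 1%N ->
  e \in gm_deg E (n + 1) -> powtors t e ->
  exists e', [/\ e' \in gm_deg E n, powtors t e' &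
    exists m : nat, x ^+ m *: (e - x *: e') = 0].
Proof.
move=> hE t1 x1 en [m0 hm0].
(* This ideal is homogeneous and kills e. Sending it to 0 will make e' torsion with the same
   exponent [m0]. *)
pose a : {pred R^o} := ideal_gen (mem [seq y ^+ m0 | y <- t]).
have ha : submod_closed a by exact: ideal_gen_submod.
have a_gen y : y \in t -> y ^+ m0 \in a.
  move=> yt; apply/asboolP; exists [:: (1, y ^+ m0)]; rewrite big_seq1 mul1r.
  by split=> // p; rewrite inE => /eqP ->; apply: map_f.
have a_kill r : r \in a -> r *: e = 0.
  move=> /asboolP[L [hL ->]]; rewrite scaler_suml big1_seq // => p /andP[_ /hL].
  by move=> /mapP[y yt ->]; rewrite -scalerA hm0 ?scaler0.
have aD u v : u \in a -> v \in a -> u + v \in a by move=> *; apply: rpredD.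
have aZ (r : R) u : u \in a -> r * u \in a by move=> ua; apply: (@rpredZ _ _ a).
have aB u v : u \in a -> v \in a -> u - v \in a.
  by move=> ua va; rewrite -mulN1r; apply: aD => //; apply: aZ.
have acomp j r : r \in a -> comp hg j r \in a.
  move=> /asboolP[L [hL ->]]; rewrite comp_bigsum big_seq.
  apply: (big_ind (fun r => r \in a)) => //; first exact: rpred0.
  move=> p /hL /mapP[y yt ->]; rewrite (compMr _ _ (exp_deg hR m0 (t1 y yt))).
  by case: ifP => _; [apply/aZ/a_gen | apply: rpred0].
(* The colon ideals a : x^k increase with k, hence stabilise. *)
have [k hk] : exists k : nat, forall r, r * x ^+ k.+1 \in a -> r * x ^+ k \in a.
  have [||||k hk] := @acc R R^o (fun=> True) (eq^~ 0) (fun k r => (r : R) * x ^+ k \in a) _ noethR.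
  - exact: is_submod1.
  - move=> k; split; first by rewrite mul0r; apply: rpred0.
    by move=> r u v ua va; rewrite mulrDl; apply: aD => //; rewrite -mulrA; apply: aZ.
  - by [].
  - by move=> k r ra; rewrite exprS mulrCA; apply: aZ.
  exists k => r /hk[w [wa /eqP]]; by rewrite subr_eq0 => /eqP ->.
pose I : {pred R^o} := fun u => `[< exists c b, b \in a /\ u = c * x ^+ k.+1 + b >].
have IP u : u \in I <-> exists c b, b \in a /\ u = c * x ^+ k.+1 + b.
  by rewrite unfold_in /I; split=> /asboolP.
have hI : submod_closed I.
  split; first by apply/IP; exists 0, 0; rewrite mul0r addr0; split=> //; apply: rpred0.
  move=> r _ _ /IP[c [b [ba ->]]] /IP[c' [b' [ba' ->]]]; apply/IP.
  exists (r * c + c'), (r * b + b'); split; first by apply: aD => //; apply: aZ.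
  by rewrite -[r *: _]/(r * _) mulrDr mulrDl mulrA addrACA.
have Icomp j r : r \in I -> comp hg j r \in I.
  move=> /IP[c [b [ba ->]]]; rewrite compD (compMr _ _ (exp_deg hR k.+1 x1)).
  apply/IP; case: ifP => _; first by exists (comp hg (j - k.+1)%N c), (comp hg j b); split=> //; apply: acomp.
  by exists 0, (comp hg j b); rewrite mul0r; split=> //; apply: acomp.
(* Well-definedness: two expressions of u give (c - c') x^(k+1) in a, hence (c - c') x^k in a, which
   kills e. Off the ideal the value is 0. *)
have h_ex u : exists v : E, forall c b, b \in a -> u = c * x ^+ k.+1 + b -> v = c *: (x ^+ k *: e).
  have [[c [b [ba eu]]]|nI] := pselect (exists c b, b \in a /\ u = c * x ^+ k.+1 + b); last first.
    by exists 0 => c b ba eu; case: nI; exists c, b.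
  exists (c *: (x ^+ k *: e)) => c' b' ba' eu'; apply/eqP.
  rewrite -subr_eq0 -scalerBl scalerA; apply/eqP/a_kill/hk.
  have -> : (c - c') * x ^+ k.+1 = b' - b.
    apply/eqP; rewrite mulrBl subr_eq addrAC eq_sym subr_eq eq_sym -eu addrC.
    by rewrite eu' addrC.
  exact: aB.
have [h hh] := choice h_ex.
have [|m r rI rm|e' e'n he'] := gr_injective_extend (c := n) hI Icomp hE (h := h).
- move=> r _ _ /IP[c [b [ba ->]]] /IP[c' [b' [ba' ->]]].
  rewrite (hh _ c b ba erefl) (hh _ c' b' ba' erefl) (hh _ (r * c + c') (r * b + b')).
  + by rewrite scalerDl -[in LHS]scalerA.
  + by apply: aD => //; apply: aZ.
  + by rewrite mulrDr mulrDl mulrA addrACA.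
(* The given c and b may be inhomogeneous; the degree m component of the expression has c replaced
   by its component of degree m - k - 1. If m <= k, then r lies in a. *)
- have [c [b [ba er]]] := (proj1 (IP r) rI).
  have : comp hg m r = r := comp_id hg rm.
  rewrite {1}er compD (compMr _ _ (exp_deg hR k.+1 x1)); case: ifP => km er'; last first.
    rewrite (hh r 0 (comp hg m b)); last by rewrite mul0r er'.
      by rewrite scale0r; apply: grading0; apply: gm_grading.
    exact: acomp.
  rewrite (hh r _ _ (acomp m b ba) (esym er')).
  have := gm_scale (comp_mem hg (m - k.+1)%N c) (gm_scale (exp_deg hR k x1) en).
  by congr (_ \in gm_deg E _); lia.
exists e'; split=> //.
  exists m0 => y /a_gen ya; rewrite -he'; last by apply/IP; exists 0, (y ^+ m0); rewrite mul0r add0r.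
  by rewrite (hh _ 0 (y ^+ m0)) ?scale0r // mul0r add0r.
(* x^(k+1) e' is the value of h at x^(k+1), namely x^k e. *)
exists k; rewrite scalerBr scalerA -exprSr -he'; last first.
  by apply/IP; exists 1, 0; rewrite mul1r addr0; split=> //; apply: rpred0.
by rewrite (hh _ 1 0) ?scale1r ?subrr ?rpred0 // mul1r addr0.
Qed.

End GradedInjective.

(** * The total complex of a resolution *)

Section ProductModule.
Variables (A : comNzRingType) (E : nat -> lmodType A).

(** [complex] wants a single ambient module. The product serves, since [tot_D] singles out elements
    concentrated in one cohomological degree. *)
Definition prodm := forall k, E k.

HB.instance Definition _ := gen_eqMixin prodm.
HB.instance Definition _ := gen_choiceMixin prodm.

Let add (f g : prodm) : prodm := fun k => f k + g k.
Let opp (f : prodm) : prodm := fun k => - f k.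
Let zero : prodm := fun k => 0.
Let scale (a : A) (f : prodm) : prodm := fun k => a *: f k.

Let addA : associative add.
Proof. by move=> f g h; apply: functional_extensionality_dep => k; apply: addrA. Qed.
Let addC : commutative add.
Proof. by move=> f g; apply: functional_extensionality_dep => k; apply: addrC. Qed.
Let add0 : left_id zero add.
Proof. by move=> f; apply: functional_extensionality_dep => k; apply: add0r. Qed.
Let addN : left_inverse zero opp add.
Proof. by move=> f; apply: functional_extensionality_dep => k; apply: addNr. Qed.
HB.instance Definition _ := GRing.isZmodule.Build prodm addA addC add0 addN.

Let scaleA a b f : scale a (scale b f) = scale (a * b) f.
Proof. by apply: functional_extensionality_dep => k; apply: scalerA. Qed.
Let scale1 : left_id 1 scale.
Proof. by move=> f; apply: functional_extensionality_dep => k; apply: scale1r. Qed.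
Let scaleDr : right_distributive scale +%R.
Proof. by move=> a f g; apply: functional_extensionality_dep => k; apply: scalerDr. Qed.
Let scaleDl f : {morph scale^~ f : a b / a + b}.
Proof. by move=> a b; apply: functional_extensionality_dep => k; apply: scalerDl. Qed.
HB.instance Definition _ :=
  GRing.Zmodule_isLmodule.Build A prodm scaleA scale1 scaleDr scaleDl.

Definition single (j : nat) (v : E j) : prodm := fun k =>
  match @eqP _ j k with
  | ReflectT e => eq_rect j (fun i => E i : Type) v k e
  | ReflectF _ => 0
  end.

Lemma single_eq j (v : E j) : single v j = v.
Proof. by rewrite /single; case: eqP => // e; rewrite (eq_irrelevance e erefl). Qed.

Lemma single_ne j (v : E j) k : j != k -> single v k = 0.
Proof. by rewrite /single; case: eqP. Qed.

End ProductModule.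

Section TotalComplex.
Variables (R0 : comNzRingType) (R : comAlgType R0) (Rn : nat -> {pred R}).
Hypothesis hR : standard_graded Rn.
Hypothesis noethR : @noeth R R^o (fun=> True) (eq^~ 0).
Variables (M : grmod Rn) (E : gr_inj_resolution M).

Local Notation V := (prodm (fun k => E k)).
Local Notation hg := (sg_grading hR).

Definition tot_d (f : V) : V := fun k =>
  match k with 0%N => 0 | j.+1 => res_d E j (f j) end.

(** With t = [::] the torsion condition is void and this is the full resolution; with t = s it is
    X. *)
Definition tot_D (t : seq R) (k n : int) (f : V) : Prop :=
  forall j, [/\ f j \in gm_deg (E j) n, powtors t (f j) & (j%:Z != k -> f j = 0)].

(** M itself, placed in cohomological degree 0 through the augmentation. *)
Definition aug_D (k n : int) (f : V) : Prop :=
  exists m, [/\ m \in gm_deg M n, (k != 0 -> m = 0),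
    f 0%N = res_aug E m & forall j, f j.+1 = 0].

Lemma res_dd k x : res_d E k.+1 (res_d E k x) = 0.
Proof. by apply/res_exactS; exists x. Qed.

Lemma tot_lin a u v : tot_d (a *: u + v) = a *: tot_d u + tot_d v.
Proof.
apply: functional_extensionality_dep => -[|j].
  by rewrite -[RHS]/(a *: 0 + 0) scaler0 addr0.
exact: linearP.
Qed.

Lemma tot_dd v : tot_d (tot_d v) = 0.
Proof.
apply: functional_extensionality_dep => -[//|[|j]] /=; first exact: linear0.
exact: res_dd.
Qed.

Lemma comp_res_d k n x :
  comp (gm_grading (E k.+1)) n (res_d E k x) = res_d E k (comp (gm_grading (E k)) n x).
Proof.
apply: (comp_map (gm_grading (E k)) (gm_grading (E k.+1)) (f := res_d E k) (phi := id)) => //.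
  exact: linearD.
exact: res_d_homog.
Qed.

Lemma comp_res_aug n x :
  comp (gm_grading (E 0%N)) n (res_aug E x) = res_aug E (comp (gm_grading M) n x).
Proof.
apply: (comp_map (gm_grading M) (gm_grading (E 0%N)) (f := res_aug E) (phi := id)) => //.
  exact: linearD.
exact: res_aug_homog.
Qed.

Lemma res_d_powtors t k (x : E k) : powtors t x -> powtors t (res_d E k x).
Proof. by move=> [m hm]; exists m => y yt; rewrite -linearZ hm ?linear0. Qed.

Lemma complex_tot t : complex (Rn 1%N) tot_d (tot_D t).
Proof.
split; [exact: tot_lin | exact: tot_dd | | |].
- move=> k n; split=> [j|a u v hu hv j].
    split=> //; first exact: (grading0 (gm_grading _)).
    exact: (submod0 (powtors_submod _ _)).
  have [du tu zu] := hu j; have [dv tv zv] := hv j; split.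
  + exact: (proj2 (deg_submod hR (E j) n)).
  + exact: (proj2 (powtors_submod (E j) t)).
  + move=> jk; rewrite -[LHS]/(a%:A *: u j + v j).
    by rewrite zu // zv // scaler0 addr0.
- move=> k n v hv [|j] /=.
    split=> //; first exact: (grading0 (gm_grading _)).
    exact: (submod0 (powtors_submod _ _)).
  have [dv tv zv] := hv j; split.
  + exact: res_d_homog.
  + exact: res_d_powtors.
  + by move=> jk; rewrite zv ?linear0 //; apply: contra jk => /eqP <-; lia.
- move=> x k n v x1 hv j; have [dv tv zv] := hv j; split.
  + by rewrite addrC; apply: gm_scale.
  + exact: (submodZ (powtors_submod _ _)).
  + by move=> /zv vj; rewrite -[LHS]/(x *: v j) vj scaler0.
Qed.

Lemma complex_aug : complex (Rn 1%N) tot_d aug_D.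
Proof.
have dz k n v : aug_D k n v -> tot_d v = 0.
  move=> [m [_ _ v0 vS]]; apply: functional_extensionality_dep => -[//|[|j]] /=.
    by rewrite v0; apply/res_exact0; exists m.
  by rewrite vS linear0.
split; [exact: tot_lin | exact: tot_dd | | |].
- move=> k n; split.
    by exists 0; split; rewrite ?linear0 //; apply: (grading0 (gm_grading _)).
  move=> a u v [m [mn mk u0 uS]] [m' [m'n m'k v0 vS]]; exists (a%:A *: m + m'); split.
  + exact: (proj2 (deg_submod hR M n)).
  + by move=> k0; rewrite mk // m'k // scaler0 addr0.
  + by rewrite linearP -u0 -v0.
  + by move=> j; rewrite -[LHS]/(a%:A *: u j.+1 + v j.+1) uS vS scaler0 addr0.
- move=> k n v /dz ->; exists 0; split; rewrite ?linear0 //; exact: (grading0 (gm_grading _)).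
- move=> x k n v x1 [m [mn mk v0 vS]]; exists (x *: m); split.
  + by rewrite addrC; apply: gm_scale.
  + by move=> /mk ->; rewrite scaler0.
  + by rewrite linearZ -v0.
  + by move=> j; rewrite -[LHS]/(x *: v j.+1) vS scaler0.
Qed.

Lemma aug_tot k n v : aug_D k n v -> tot_D [::] k n v.
Proof.
move=> [m [mn mk v0 vS]] [|j]; split.
- by rewrite v0; apply: res_aug_homog.
- by exists 0%N.
- by move=> k0; rewrite v0 mk ?linear0 // eq_sym.
- by rewrite vS; apply: (grading0 (gm_grading _)).
- by exists 0%N.
- by rewrite vS.
Qed.

Lemma single_tot t j n (v : E j) :
  v \in gm_deg (E j) n -> powtors t v -> tot_D t j%:Z n (single v : V).
Proof.
move=> vn vt k; have [<-|jk] := eqVneq j k.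
  by rewrite single_eq; split=> //; rewrite eqxx.
rewrite single_ne //; split=> //; first exact: (grading0 (gm_grading _)).
exact: (submod0 (powtors_submod _ _)).
Qed.

Lemma tot_d_single j (v : E j) k :
  tot_d (single v : V) k.+1 = if j == k then (single (res_d E j v) : V) k.+1 else 0.
Proof.
rewrite /=; have [<-|jk] := eqVneq j k; first by rewrite !single_eq.
by rewrite single_ne // linear0.
Qed.

(** This is the exactness of the resolution. Preimages given by exactness may be inhomogeneous, and
    their degree n components are taken. *)
Lemma acyc_aug : acyc tot_d aug_D (tot_D [::]).
Proof.
move=> k n v Dv [_ [_ _ _ dv]].
have aug0 w : (forall j, w j = 0) -> aug_D k n w.
  move=> w0; exists 0; split=> [|||j]; rewrite ?linear0 ?w0 //; exact: (grading0 (gm_grading _)).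
case: k Dv aug0 => [[|j]|j] Dv aug0.
- have [y ey] : exists y, v 0%N = res_aug E y by apply/res_exact0/dv.
  exists 0; first exact: (D0 (complex_tot _)).
  rewrite (d0 (complex_tot [::])) subr0; exists (comp (gm_grading M) n y); split=> //.
  + exact: comp_mem.
  + rewrite -comp_res_aug -ey comp_id //; by case: (Dv 0%N).
  + by move=> j; case: (Dv j.+1) => _ _; apply.
- have [y ey] : exists y, v j.+1 = res_d E j y by apply/res_exactS/dv.
  pose y' := comp (gm_grading (E j)) n y.
  have ey' : v j.+1 = res_d E j y'.
    by rewrite -comp_res_d -ey comp_id //; case: (Dv j.+1).
  exists (single y' : V).
    rewrite (_ : j.+1%:Z - 1 = j%:Z); last by lia.
    by apply: single_tot; [exact: comp_mem|exists 0%N].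
  apply: aug0 => -[|i]; rewrite -[LHS]/(v _ - tot_d (single y' : V) _).
    by rewrite subr0; case: (Dv 0%N) => _ _; apply.
  have [<-|ji] := eqVneq j i; first by rewrite /= single_eq ey' subrr.
  rewrite /= single_ne // linear0 subr0; case: (Dv i.+1) => _ _; apply.
  by apply: contra ji => /eqP[->].
- exists 0; first exact: (D0 (complex_tot _)).
  rewrite (d0 (complex_tot [::])) subr0; apply: aug0 => i.
  by case: (Dv i) => _ _; apply.
Qed.

(** Injectivity modulo x-torsion holds in any module; surjectivity is [gr_injective_divide], applied
    in place k, with 0 chosen elsewhere. *)
Lemma bij_mod_tot t x : {subset t <= Rn 1%N} -> x \in Rn 1%N ->
  bij_mod (tot_D (x :: t)) (tot_D t) x.
Proof.
move=> t1 x1; split=> [k n v Dv Dxv j|k n v Dv].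
  have [vn vt vk] := Dv j; split=> //; apply/powtors_cons; split=> //.
  have [_ /powtors_cons[[m hm] _] _] := Dxv j.
  by exists m.+1; rewrite exprSr -scalerA.
have ex j : exists w : E j, [/\ w \in gm_deg (E j) n, powtors t w,
    (j%:Z != k -> w = 0) & exists m : nat, x ^+ m *: (v j - x *: w) = 0].
  have [vn vt vk] := Dv j; have [jk|/vk v0] := eqVneq j%:Z k.
    have [w [wn wt xw]] := gr_injective_divide hR noethR (@res_inj _ _ _ _ E j) t1 x1 vn vt.
    by exists w.
  exists 0; split=> //; first exact: (grading0 (gm_grading _)).
    exact: (submod0 (powtors_submod _ _)).
  by exists 0%N; rewrite v0 scaler0 subrr scaler0.
pose w : V := fun j => projT1 (cid (ex j)).
have hw j := projT2 (cid (ex j)); exists w; first by move=> j; case: (hw j).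
move=> j; have [vn vt vk] := Dv j; have [wn wt wk xw] := hw j; split.
- by apply: (gradingB (gm_grading _)) => //; rewrite addrC; apply: gm_scale.
- apply/powtors_cons; split=> //; apply: (submodB (powtors_submod _ _)) => //.
  exact: (submodZ (powtors_submod _ _)).
- by move=> jk; rewrite -[LHS]/(v j - x *: w j) vk // [w j]wk // scaler0 subrr.
Qed.

(** The torsion sequence [t] grows from [::] to s while the Koszul sequence s stays fixed. For t =
    [::] the resolution is exchanged for M, where finiteness is visible. *)
Lemma koszul_good_tot s : {subset s <= Rn 1%N} -> @fin_gen R M predT ->
  koszul_good s tot_d (tot_D s).
Proof.
move=> s1 hM.
suff main t : {subset t <= s} -> koszul_good s tot_d (tot_D t) by exact: main.
elim: t => [_|x t IH xts]; last first.
  have xs : x \in s by apply: xts; rewrite mem_head.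
  have ts : {subset t <= s} by move=> y yt; apply: xts; rewrite inE yt orbT.
  apply/(koszul_good_bij s1 xs (complex_tot (x :: t)) (complex_tot t)); last exact: IH.
    by move=> k n v Dv j; have [vn /powtors_cons[_ vt] vk] := Dv j.
  by apply: bij_mod_tot; [move=> y /ts/s1|exact: s1].
rewrite -(koszul_good_acyc s1 complex_aug (complex_tot [::]) aug_tot acyc_aug).
apply: koszul_good_finite s1 complex_aug _ _.
  have [N hN] := deg_below hR hM; move=> k; exists N => n nN v [m [mn _ v0 vS]].
  apply: functional_extensionality_dep => -[|j]; last exact: vS.
  by rewrite v0 (hN n nN m mn) linear0.
move=> k n.
pose iota (m : M) : V := fun k => match k with 0%N => res_aug E m | _ => 0 end.
apply: (@noeth_surj R0 (restr_scalars V) (restr_scalars M) _ _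
  (fun m => m \in gm_deg M n) (eq^~ 0) iota).
- move=> a u v; apply: functional_extensionality_dep => -[|j]; first exact: linearP.
  by rewrite -[RHS]/(a%:A *: 0 + 0) scaler0 addr0.
- exact: deg_submod.
- exact: is_submod1.
- move=> _ ->; apply: functional_extensionality_dep => -[|j] //; exact: linear0.
- move=> v [m [mn _ v0 vS]]; exists m; split=> //.
  apply: functional_extensionality_dep => -[|j].
    by rewrite -[LHS]/(v 0%N - res_aug E m) v0 subrr.
  by rewrite -[LHS]/(v j.+1 - 0) vS subrr.
exact: noeth_deg.
Qed.

End TotalComplex.

(** * Local cohomology as cohomology of the total complex *)

Section LocalCohomology.
Variables (R0 : comNzRingType) (R : comAlgType R0) (Rn : nat -> {pred R}).
Hypothesis hR : standard_graded Rn.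
Hypothesis noethR : @noeth R R^o (fun=> True) (eq^~ 0).
Variable s : seq R.
Hypotheses (s1 : {subset s <= Rn 1%N})
  (sgen : forall S : {pred R}, subalg_closed S -> {subset s <= S} -> S =i predT).
Variables (m0 J0 : idealr R0).
Hypotheses (hlocal : local_ring m0) (J0m : {subset J0 <= m0}).
Variables (M : grmod Rn) (E : gr_inj_resolution M).

Local Notation V := (prodm (fun k => E k)).
Local Notation I := (irrelevant Rn).
Local Notation J := (extend_ideal R J0).
Local Notation Zn k n := (cyc (@tot_d _ _ _ _ E) (@tot_D _ _ _ _ E s) k n).
Local Notation Bn k n := (bnd (@tot_d _ _ _ _ E) (@tot_D _ _ _ _ E s) k n).
Local Notation qp k := (quot_proj (coboundary I J E k)).

Lemma torsionE (N : grmod Rn) (x : N) : x \in torsion I J N <-> powtors s x.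
Proof.
split; first exact: (torsion_powtors hR noethR s1 sgen hlocal J0m).
exact: (powtors_torsion hR s1 sgen).
Qed.

Lemma cyc_eval k n (f : V) :
  Zn k%:Z n f -> f k \in cocycle I J E k /\ f k \in gm_deg (E k) n.
Proof.
move=> [Df df]; have [fn ft _] := Df k; split=> //.
apply/andP; split; first exact/torsionE.
by apply/eqP; have := congr1 (fun g : V => g k.+1) df.
Qed.

Lemma cyc_single k n (z : E k) :
  z \in cocycle I J E k -> z \in gm_deg (E k) n -> Zn k%:Z n (single z : V).
Proof.
move=> /andP[/torsionE zt /eqP dz] zn; split; first exact: single_tot.
apply: functional_extensionality_dep => -[//|j].
rewrite tot_d_single dz; case: eqP => [<-|//]; by rewrite single_eq.
Qed.

(** By [torsionE] the torsion submodule is stable under taking components, and the differential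
    commutes with them. *)
Lemma comp_coboundary k n (y : E k) : y \in coboundary I J E k ->
  comp (gm_grading (E k)) n y \in coboundary I J E k.
Proof.
case: k y => [|k] y; first by move=> /eqP ->; rewrite comp0; apply: eqxx.
move=> /asboolP[x /torsionE xt ->]; rewrite comp_res_d.
apply/asboolP; exists (comp (gm_grading (E k)) n x) => //.
by apply/torsionE/powtors_comp.
Qed.

Lemma single_coboundary k n (y : E k) : y \in coboundary I J E k ->
  y \in gm_deg (E k) n -> Bn k%:Z n (single y : V).
Proof.
case: k y => [|k] y.
  move=> /eqP -> _; exists 0; first exact: (D0 (complex_tot hR E s)).
  rewrite (d0 (complex_tot hR E s)); apply: functional_extensionality_dep => -[|j].
    by rewrite single_eq.
  by rewrite single_ne.
move=> /asboolP[x /torsionE xt ey] yn.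
exists (single (comp (gm_grading (E k)) n x) : V).
  rewrite (_ : k.+1%:Z - 1 = k%:Z); last by lia.
  by apply: single_tot; [exact: comp_mem | exact: powtors_comp].
apply: functional_extensionality_dep => -[|j]; first by rewrite single_ne.
rewrite tot_d_single -comp_res_d -ey comp_id //.
by have [<-//|kj] := eqVneq k j; rewrite single_ne // eqSS.
Qed.

Lemma cyc_eta k n (f : V) : Zn k%:Z n f -> f = single (f k).
Proof.
move=> [Df _]; apply: functional_extensionality_dep => j.
have [<-|kj] := eqVneq k j; first by rewrite single_eq.
rewrite single_ne //; case: (Df j) => _ _; apply.
by apply: contra kj => /eqP[->].
Qed.

(** Evaluation in place k is injective on cohomology; with [cyc_single] it identifies the degree n
    cohomology of X with [loc_coh_deg]. *)
Lemma bnd_eval k n (f : V) :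
  Zn k%:Z n f -> Bn k%:Z n f <-> f k \in coboundary I J E k.
Proof.
move=> Zf; split; last first.
  move=> fB; rewrite (cyc_eta Zf); apply: single_coboundary => //.
  by case: (cyc_eval Zf).
move=> [w Dw ->]; case: k Dw {Zf} => [|k] Dw; first exact: eqxx.
apply/asboolP; exists (w k) => //; apply/torsionE.
by case: (Dw k).
Qed.

Lemma quot_proj0 k z : qp k z = 0 <-> z \in coboundary I J E k.
Proof.
have -> : (0 : quot_mod (coboundary I J E k)) = qp k 0.
  by apply: (addIr (qp k 0)); rewrite add0r -quot_projD addr0.
by rewrite quot_projP subr0.
Qed.

Lemma Ass_loc_coh k n p :
  Ass (loc_coh_deg I J E k n) p <->
  @assq R0 (restr_scalars V) (Zn k%:Z n) (Bn k%:Z n) p.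
Proof.
have scal (a : R0) (z : E k) : ((a *: (qp k z : restr_scalars _)) == 0) <->
    (a%:A *: z) \in coboundary I J E k.
  rewrite -quot_proj0 -quot_scaleE; split=> [/eqP //|e]; exact/eqP.
split=> [[ip pp [u /asboolP[z [zZ zn ->]] hu]]|[ip pp [f Zf hf]]].
  split=> //; exists (single z : V); first exact: cyc_single.
  move=> a; rewrite hu inE scal.
  have Zz := submodZ (cyc_submod (complex_tot hR E s) k%:Z n) a (cyc_single zZ zn).
  have : Bn k%:Z n (a%:A *: (single z : V)) <->
      a%:A *: (single z : V) k \in coboundary I J E k := bnd_eval Zz.
  by rewrite single_eq => ->.
have [fZ fn] := cyc_eval Zf; split=> //; exists (qp k (f k)).
  by apply/asboolP; exists (f k).
have pE a : a \in p <-> (a *: (qp k (f k) : restr_scalars _)) == 0.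
  rewrite hf scal.
  by rewrite (bnd_eval (submodZ (cyc_submod (complex_tot hR E s) k%:Z n) a Zf)).
by move=> a; apply/idP/idP => /pE.
Qed.

Lemma coh_zero_neg k n : k < 0 -> coh_zero (@tot_d _ _ _ _ E) (@tot_D _ _ _ _ E s) k n.
Proof.
move=> k0 f [Df _]; suff -> : f = 0 by apply: (submod0 (bnd_submod (complex_tot hR E s) k n)).
apply: functional_extensionality_dep => j; case: (Df j) => _ _; apply.
by apply/eqP; lia.
Qed.

(** Lift the generators to finitely many [zs] in E^k, which have no components in degrees <= N. A
    cocycle of degree n <= N differs from a combination of [zs] by a coboundary, and its degree n
    component is that of the coboundary. *)
Lemma loc_coh_low k : fin_gen (loc_coh I J E k) ->
  exists N, forall n, n <= N -> coh_zero (@tot_d _ _ _ _ E) (@tot_D _ _ _ _ E s) k%:Z n.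
Proof.
move=> /fin_gen_span[us [usH usgen]].
have [zs hzs] : exists zs : seq (E k), us = map (qp k) zs.
  elim: us usH {usgen} => [|u us IH] usH; first by exists [::].
  have [zs ->] := IH (fun v vus => usH v (mem_behead (s := u :: us) vus)).
  by have /asboolP[z _ ->] := usH u (mem_head _ _); exists (z :: zs).
have [N hN] := below_span hR (M := E k) zs.
exists N => n nN f Zf; apply/(bnd_eval Zf); have [fZ fn] := cyc_eval Zf.
have /usgen : qp k (f k) \in loc_coh I J E k by apply/asboolP; exists (f k).
have span_lift u : lspan us u -> exists z, lspan zs z /\ u = qp k z.
  move=> hu; pattern u; apply: hu.
    split; first by exists 0; split; [exact: (submod0 (lspan_submod zs))|apply/esym/quot_proj0; apply: rpred0].
    move=> a _ _ [x [hx ->]] [y [hy ->]]; exists (a *: x + y).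
    split; first exact: (proj2 (lspan_submod zs)).
    by rewrite quot_projD -quot_scaleE.
  by move=> x; rewrite hzs => /mapP[z zz ->]; exists z; split=> //; apply: lspan_mem.
move=> /span_lift[z [hz /quot_projP efz]].
have cn : comp (gm_grading (E k)) n (f k - z) = f k.
  by rewrite compB (comp_id _ fn) (hN z hz n nN) subr0.
by rewrite -cn; apply: comp_coboundary.
Qed.

Lemma loc_coh_vanish k n : loc_coh_deg I J E k n =i pred1 0 ->
  coh_zero (@tot_d _ _ _ _ E) (@tot_D _ _ _ _ E s) k%:Z n.
Proof.
move=> h0 f Zf; apply/(bnd_eval Zf); have [fZ fn] := cyc_eval Zf.
apply/quot_proj0/eqP; rewrite -[_ == _]/(_ \in pred1 0) -h0.
by apply/asboolP; exists (f k).
Qed.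

Lemma loc_coh_noeth k n : fin_gen (loc_coh_deg I J E k n) ->
  coh_noeth (@tot_d _ _ _ _ E) (@tot_D _ _ _ _ E s) k%:Z n.
Proof.
move=> /fin_gen_span[us [_ usgen]].
apply: (@noeth_inj R0 (restr_scalars V)
  (restr_scalars (quot_mod (coboundary I J E k))) _ _ (lspan us) (eq^~ 0)
  (fun f => qp k ((f : V) k))).
- by move=> a u v; rewrite quot_projD -quot_scaleE.
- exact: (bnd_submod (complex_tot hR E s)).
- move=> f Zf; have [fZ fn] := cyc_eval Zf.
  by apply: usgen; apply/asboolP; exists (f k).
- by move=> f Zf /quot_proj0/(bnd_eval Zf).
- exact: (noeth_span (noethR0 hR noethR)).
Qed.

End LocalCohomology.

Theorem theorem4p1
    (R0 : comNzRingType) (R : comAlgType R0) (Rn : nat -> {pred R})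
    (hR : standard_graded Rn) (hnoeth : noetherian R)
    (m0 : idealr R0) (hlocal : local_ring m0)
    (hinf : infinite_set [set: {ideal_quot m0}]%classic)
    (J0 : idealr R0) (hJ0 : {subset J0 <= m0})
    (M : grmod Rn) (hM : @fin_gen R M predT)
    (E : gr_inj_resolution M) (i : nat)
    (hfg : forall j, (j < i)%N ->
       fin_gen (loc_coh (irrelevant Rn) (extend_ideal R J0) E j))
    (hab :
       (forall N : grmod Rn, @fin_gen R N predT ->
        forall (F : gr_inj_resolution N) (k : nat),
          exists n0 : int, forall n : int, n0 <= n ->
            loc_coh_deg (irrelevant Rn) (extend_ideal R J0) F k n =i pred1 0)
       \/
       (forall N : grmod Rn, @fin_gen R N predT ->
        forall (F : gr_inj_resolution N) (k : nat) (n : int),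
          fin_gen (loc_coh_deg (irrelevant Rn) (extend_ideal R J0) F k n))) :
  exists n0 : int, forall n : int, n <= n0 ->
    Ass (loc_coh_deg (irrelevant Rn) (extend_ideal R J0) E i n) =
    Ass (loc_coh_deg (irrelevant Rn) (extend_ideal R J0) E i n0).
Proof.
have noethR := noetherian_noeth hnoeth.
have [s [s1 sgen]] := sg_gen hR.
have hX := complex_tot hR E s.
have good := koszul_good_tot hR noethR E s1 hM.
(* The meeting point of the two conditions: (a) goes through the Koszul complex, (b) gives it
   directly. *)
have hN k n : coh_noeth (@tot_d _ _ _ _ E) (@tot_D _ _ _ _ E s) k n.
  case: hab => [van|fg].
    apply: (koszul_coh_noeth s1 hX good) => {n}[[k'|k']]; last first.
      by exists 0 => n _; apply: coh_zero_neg.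
    have [n0 h0] := van M hM E k'; exists n0 => n /h0.
    exact: (loc_coh_vanish hR noethR s1 sgen hlocal hJ0).
  case: k => k; last by apply/coh_zero_noeth/coh_zero_neg.
  exact: (loc_coh_noeth hR noethR s1 sgen hlocal hJ0 (fg M hM E k n)).
have [|N stab] := koszul_assq_stable (i := i) (noethR0 hR noethR) s1 hX good hN.
  move=> [j|j] ji; last by exists 0 => n _; apply: coh_zero_neg.
  exact: (loc_coh_low hR noethR s1 sgen hlocal hJ0 (hfg j ji)).
exists N => n nN; apply/seteqP; split=> p.
  move=> /(Ass_loc_coh hR noethR s1 sgen hlocal hJ0)/(stab n p nN).
  exact: (proj2 (Ass_loc_coh hR noethR s1 sgen hlocal hJ0 _ _ _ _)).
move=> /(Ass_loc_coh hR noethR s1 sgen hlocal hJ0)/(stab n p nN).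
exact: (proj2 (Ass_loc_coh hR noethR s1 sgen hlocal hJ0 _ _ _ _)).
Qed.
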